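(* Let $G$ be a maximal outerplanar graph. If $G$ has a planar flat visibility representation of height $H$, then $ud^{\mathit{free}}(G)\le H-1$.
   Context: A maximal outerplanar graph is a simple graph $G$ with $n\ge 3$ vertices having a planar embedding (the standard embedding) in which all vertices lie on the outer face and form an $n$-cycle, and all interior faces are triangles. An edge $(u,v)$ is a cutting edge if $G-\{u,v\}$ is disconnected, and a non-cutting edge otherwise. For a cutting edge $(u,v)$ there are exactly two cut-components: maximal outerplanar subgraphs $G_1,G_2$ with $G_1\cap G_2=\{u,v\}$ and $G_1\cup G_2=G$. The dual tree of $G$ has a node per interior face of the standard embedding, adjacent iff the faces share an edge. An outerplanar path is a maximal outerplanar graph whose dual tree is a path $f_1,\dots,f_k$; it connects edges $e,e'$ if $e$ is incident to $f_1$ and $e'$ to $f_k$ (a triangle connects any two of its edges). Umbrella: for a non-cutting edge $(u,v)$ of $G$, an umbrella with cap $(u,v)$ is a subgraph $U$ of $G$ with at least 3 vertices that is the union of three outerplanar paths $P$ (the handle), $F_1,F_2$ (the fans, possibly empty) such that: (1) $P$ connects $(u,v)$ to some other non-cutting edge of $G$; (2) $F_1$ contains only $u$ and neighbours of $u$, and $F_2$ only $v$ and neighbours of $v$; (3) $F_1,F_2$ are edge-disjoint, $F_1$ and $P$ share exactly one edge (incident to $u$), $F_2$ and $P$ share exactly one edge (incident to $v$); (4) all neighbours of $u$ and $v$ in $G$ belong to $U$. An anchor-edge of $U$ is an edge of $U$ that is a cutting edge of $G$ but not of $U$; the hanging subgraph at anchor-edge $(a,b)$ is the cut-component of $G$ w.r.t.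 $(a,b)$ not containing $(u,v)$. An umbrella system of $G$ with root-edge $(u,v)$ (non-cutting) consists of an umbrella $U_0$ in $G$ with cap $(u,v)$, with anchor-edges $(u_i,v_i)$, $i=1,\dots,k$ ($k\ge0$), and for each $i$ an umbrella system of the hanging subgraph $S_i$ (itself maximal outerplanar) with root-edge $(u_i,v_i)$. Its depth is $1+\max_i$ (depth of the $i$-th hanging system), with max over the empty set $=0$. $ud(G;u,v)$ is the minimum depth of an umbrella system with root-edge $(u,v)$, and $ud^{\mathit{free}}(G)$ is the minimum of $ud(G;u,v)$ over all non-cutting edges $(u,v)$. A flat visibility representation represents each vertex by a horizontal segment and each edge by a horizontal or vertical segment joining its endpoints' segments; planar means no two elements intersect unless the corresponding graph elements are incident. All segment endpoints have integer $y$-coordinates; a layer is a horizontal line with integer $y$-coordinate meeting the drawing; the height is the number of layers. *)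

(* Defs.v *)
From HB Require Import structures.
From mathcomp Require Import all_boot all_order all_algebra all_fingroup.

Set Implicit Arguments.
Unset Strict Implicit.
Unset Printing Implicit Defensive.

Import Order.TTheory GRing.Theory Num.Theory.

(** * Finite simple graphs

    All graphs live on subsets of an ambient finite type [V], so that a
    subgraph is a graph of the same type.  An edge is a two-element set of
    vertices. *)

Record sgraph (V : finType) := SGraph {
  vert : {set V};
  edge : {set {set V}};
  _ : [forall A in edge, (#|A| == 2) && (A \subset vert)]
}.

Section Graphs.

Variable V : finType.
Implicit Types (G P F U S : sgraph V) (A B : {set V}) (u v : V).

Definition adj G : rel V := [rel x y | [set x; y] \in edge G].

Definition neighbours G u : {set V} := [set x | adj G u x].

Definition subgraph U G : bool :=
  (vert U \subset vert G) && (edge U \subset edge G).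

Definition is_empty F : bool := vert F == set0.

(* The subgraph of [G] induced by [W] is connected. *)
Definition connected_on G (W : {set V}) : bool :=
  [forall x in W, forall y in W,
     connect [rel a b | [&& a \in W, b \in W & adj G a b]] x y].

Definition cutting_edge G A : bool :=
  (A \in edge G) && ~~ connected_on G (vert G :\: A).

Definition non_cutting_edge G A : bool :=
  (A \in edge G) && ~~ cutting_edge G A.

(** * Planar embeddings

    An embedding in the sphere, up to homeomorphism, is given by a rotation
    system: [rho] permutes the darts (oriented edges) cyclically around their
    source vertex.  Its faces are the orbits of [face_next rho]; it is planar
    when it satisfies Euler's formula.  The values of [rho] on pairs that are
    not darts play no role. *)

Definition darts G : {set V * V} := [set d : V * V | adj G d.1 d.2].

Definition rev_dart (d : V * V) : V * V := (d.2, d.1).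

Definition rotation_system G (rho : {perm V * V}) : Prop :=
  forall d, d \in darts G ->
    porbit rho d = [set d' in darts G | d'.1 == d.1].

Definition face_next (rho : {perm V * V}) (d : V * V) : V * V :=
  rho (rev_dart d).

Definition face_of (rho : {perm V * V}) (d : V * V) : {set V * V} :=
  [set d' | fconnect (face_next rho) d d'].

Definition faces G (rho : {perm V * V}) : {set {set V * V}} :=
  [set face_of rho d | d in darts G].

Definition planar_embedding G (rho : {perm V * V}) : Prop :=
  [/\ rotation_system G rho,
      connected_on G (vert G)
    & #|vert G| + #|faces G rho| = #|edge G| + 2].

(* [o] is the outer face. Its boundary walk visits every vertex exactly once,
   i.e. it is a Hamiltonian cycle of [G]. *)
Definition standard_embedding G (rho : {perm V * V}) (o : {set V * V}) : Prop :=
  [/\ planar_embedding G rho,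
      o \in faces G rho,
      {in o &, injective fst},
      [set d.1 | d in o] = vert G
    & forall f, f \in faces G rho :\ o -> #|f| = 3].

Definition maximal_outerplanar G : Prop :=
  3 <= #|vert G| /\ exists rho o, standard_embedding G rho o.

(** * Dual trees and outerplanar paths *)

Definition interior_faces G (rho : {perm V * V}) (o : {set V * V}) :=
  faces G rho :\ o.

Definition incident A (f : {set V * V}) : bool :=
  [exists d in f, [set d.1; d.2] == A].

Definition share_edge G (f f' : {set V * V}) : bool :=
  [exists A in edge G, incident A f && incident A f'].

(* The sequence [fs] lists the nodes of the dual tree, and this tree is the
   path whose nodes are in the order of [fs]. *)
Definition dual_path G (rho : {perm V * V}) (o : {set V * V})
    (fs : seq {set V * V}) : Prop :=
  [/\ uniq fs,
      fs =i interior_faces G rho o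
    & forall i j, i < size fs -> j < size fs -> i != j ->
        share_edge G (nth set0 fs i) (nth set0 fs j)
        = (j == i.+1) || (i == j.+1)].

Definition outerplanar_path P : Prop :=
  3 <= #|vert P| /\
  exists rho o fs, standard_embedding P rho o /\ dual_path P rho o fs.

Definition connects P A B : Prop :=
  3 <= #|vert P| /\
  exists rho o fs,
    [/\ standard_embedding P rho o, dual_path P rho o fs,
        incident A (nth set0 fs 0) & incident B (nth set0 fs (size fs).-1)].

(** * Cut-components *)

Definition cut_components G A G1 G2 : Prop :=
  [/\ [/\ maximal_outerplanar G1, maximal_outerplanar G2,
          subgraph G1 G & subgraph G2 G],
      vert G1 :&: vert G2 = A,
      vert G1 :|: vert G2 = vert G
    & edge G1 :|: edge G2 = edge G].

(* [S] is the cut-component of [G] at [A] not containing the edge [B]. *)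
Definition hanging_subgraph G B A S : Prop :=
  B \notin edge S /\ exists S', cut_components G A S S'.

(** * Umbrellas *)

(* [F] is a (possibly empty) fan at [u] of an umbrella with handle [P]. *)
Definition fan G P u F : Prop :=
  is_empty F \/
  [/\ outerplanar_path F,
      vert F \subset u |: neighbours G u
    & exists2 A, edge F :&: edge P = [set A] & u \in A].

Definition umbrella_parts G u v U P F1 F2 : Prop :=
  [/\ [/\ subgraph U G, 3 <= #|vert U|,
          vert U = vert P :|: vert F1 :|: vert F2
        & edge U = edge P :|: edge F1 :|: edge F2],
      exists B, [/\ non_cutting_edge G B, B != [set u; v]
                  & connects P [set u; v] B],
      fan G P u F1 /\ fan G P v F2,
      [disjoint edge F1 & edge F2]
    & neighbours G u :|: neighbours G v \subset vert U].

Definition umbrella G B U : Prop :=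
  non_cutting_edge G B /\
  exists u v, B = [set u; v] /\ exists P F1 F2, umbrella_parts G u v U P F1 F2.

Definition anchor_edges G U : {set {set V}} :=
  [set A in edge U | cutting_edge G A && ~~ cutting_edge U A].

(** * Umbrella systems

    [umbrella_system G B d]: there is an umbrella system of [G] with root-edge
    [B] whose depth is exactly [d].  The functions [S] and [d] matter only on
    the anchor-edges of the root umbrella, and the maximum over an empty
    range is 0. *)

Inductive umbrella_system : sgraph V -> {set V} -> nat -> Prop :=
| UmbrellaSystem G B U (S : {set V} -> sgraph V) (d : {set V} -> nat) :
    umbrella G B U ->
    (forall A, A \in anchor_edges G U -> hanging_subgraph G B A (S A)) ->
    (forall A, A \in anchor_edges G U -> umbrella_system (S A) A (d A)) ->
    umbrella_system G B (1 + \max_(A in anchor_edges G U) d A).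

Definition is_minimum (Q : nat -> Prop) (m : nat) : Prop :=
  Q m /\ forall k, Q k -> m <= k.

(* The minima [ud(G; B)] and [ud^free(G)] are relations, so that a minimum
   over an empty set does not receive a default value. *)
Definition ud G B (m : nat) : Prop := is_minimum (umbrella_system G B) m.

Definition ud_free G (m : nat) : Prop :=
  is_minimum (fun k => exists2 B, non_cutting_edge G B & ud G B k) m.

End Graphs.

(** * Flat visibility representations *)

Section Drawings.

Local Open Scope ring_scope.

Variable R : realFieldType.

(* The segment from [(x1, y1)] to [(x2, y2)]; only horizontal and vertical ones
   are used. *)
Record segment := Segment { x1 : R; y1 : int; x2 : R; y2 : int }.

Definition horizontal (s : segment) : bool := (x1 s <= x2 s) && (y1 s == y2 s).

Definition vertical (s : segment) : bool := (x1 s == x2 s) && (y1 s <= y2 s).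

Definition on_segment (s : segment) (p : R * R) : bool :=
  (x1 s <= p.1 <= x2 s) && ((y1 s)%:~R <= p.2 <= (y2 s)%:~R).

Definition disjoint_segments (s t : segment) : Prop :=
  forall p, ~~ (on_segment s p && on_segment t p).

Definition end1 (s : segment) : R * R := (x1 s, (y1 s)%:~R).
Definition end2 (s : segment) : R * R := (x2 s, (y2 s)%:~R).

Definition joins (s t t' : segment) : bool :=
  (on_segment t (end1 s) && on_segment t' (end2 s))
  || (on_segment t' (end1 s) && on_segment t (end2 s)).

Record drawing (V : finType) := Drawing {
  vseg : V -> segment;
  eseg : {set V} -> segment
}.

Variable V : finType.
Implicit Types (G : sgraph V) (D : drawing V).

Definition flat_visibility_representation G D : Prop :=
  [/\ forall v, v \in vert G -> horizontal (vseg D v),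
      forall A, A \in edge G -> horizontal (eseg D A) || vertical (eseg D A)
    & forall u v, [set u; v] \in edge G ->
        joins (eseg D [set u; v]) (vseg D u) (vseg D v)].

(* A vertex and an edge containing it, or two edges with a common end, are
   incident and hence may meet. *)
Definition planar_drawing G D : Prop :=
  [/\ forall u v, u \in vert G -> v \in vert G -> u != v ->
        disjoint_segments (vseg D u) (vseg D v),
      forall v A, v \in vert G -> A \in edge G -> v \notin A ->
        disjoint_segments (vseg D v) (eseg D A)
    & forall A B : {set V}, A \in edge G -> B \in edge G -> [disjoint A & B] ->
        disjoint_segments (eseg D A) (eseg D B)].

(* The horizontal line with [y]-coordinate [k] meets the drawing. *)
Definition layer G D (k : int) : Prop :=
  exists x : R,
    (exists2 v, v \in vert G & on_segment (vseg D v) (x, k%:~R)) \/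
    (exists2 A, A \in edge G & on_segment (eseg D A) (x, k%:~R)).

Definition height G D (H : nat) : Prop :=
  exists s : seq int, [/\ uniq s, size s = H & forall k, k \in s <-> layer G D k].

End Drawings.

(* Main.v *)
(* Sweeping the drawing from left to right turns it into a path decomposition of
   G with bags of at most H + 1 vertices: every vertex lives from its left end up
   to the left end of the next vertex on its layer.  Only adjacency and the size
   of bags are used from then on.

   Let G have a root-edge uv, and let w be the vertex whose interval starts last.
   Take the umbrella whose handle runs from uv to an outer edge pq at w; both p
   and q lie in the bag where w starts.  A subgraph S hanging at an anchor-edge xy
   avoids u and v, because all their neighbours belong to the umbrella.  Going
   around the outer cycle, one way leads from u or v to pq without touching S, and
   the other way leads from S to pq.  The first path takes one vertex of every bag
   that it crosses, so S lives in bags smaller by one; the second path plays for S,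
   with left and right exchanged, the role that a path from u to the left end
   played for G.  By induction S has an umbrella system of depth at most
   (H + 1) - 3, and the whole system has depth at most (H + 1) - 2. *)

(* A path from [u0] occupies only the bags from the start of [u0] on, so a bound on the size of bags
   alone does not improve for a hanging piece. The induction therefore uses
   [#|bag x| + (x < l u0) <= T], whose second summand is a place kept free before [u0] starts. For
   the whole graph there is no surrounding path; the place is free because the root-edge is chosen
   at the vertex whose interval ends first. In [k.+2 <= T] the constant comes from triangles: three
   pairwise adjacent vertices share a bag, so [T] is at least 3, and [T = 3] leaves depth 1. The 1
   in H + 1 pays for horizontal edges, whose ends have disjoint segments on one layer but must share
   a bag. Umbrellas and cut-components are defined through embeddings and dual trees. Binary trees
   keep the induction free of both: Euler's formula turns the given embedding into a tree, and every
   tree with at least one triangle and distinct vertices carries an explicit embedding. *)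
Require Import Defs.
From mathcomp Require Import all_boot all_order all_algebra all_fingroup.
From mathcomp Require Import zify.
From Stdlib Require Import Classical.

Set Implicit Arguments.
Unset Strict Implicit.
Unset Printing Implicit Defensive.

Import Order.TTheory GRing.Theory Num.Theory.

(** * Triangulated polygons as binary trees *)

Section Trees.

Variable V : finType.

(* A tree [t] with a root edge [ab] stands for a triangulated polygon with outer
   cycle [cyc a t b]: [Node t1 c t2] is the triangle [abc], to which the polygons
   [a t1 c] and [c t2 b] are glued, and [Leaf] is the bare edge [ab].  The edges
   are [prs a t b], the outer ones other than [ab] are [sides a t b], and
   [drt a t b] lists both darts of every edge. *)
Inductive tree := Leaf | Node of tree & V & tree.

Implicit Types (t : tree) (a b c x y z : V).

Definition is_leaf t := if t is Leaf then true else false.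

Fixpoint inner t : seq V :=
  if t is Node t1 c t2 then inner t1 ++ c :: inner t2 else [::].

Definition cyc a t b : seq V := a :: inner t ++ [:: b].

Fixpoint prs a t b : seq (V * V) :=
  (a, b) :: if t is Node t1 c t2 then prs a t1 c ++ prs c t2 b else [::].

Fixpoint sides a t b : seq (V * V) :=
  if t is Node t1 c t2 then sides a t1 c ++ sides c t2 b else [:: (a, b)].

Definition drt a t b := prs a t b ++ map (@rev_dart V) (prs a t b).

Definition pset (p : V * V) : {set V} := [set p.1; p.2].

(** The filter makes every tree a legal [sgraph], even one with repeated vertices; when [cyc a t b]
    is duplicate-free it removes nothing ([edge_polyP]). *)
Definition poly_edges a t b : {set {set V}} :=
  [set A in map pset (prs a t b) | (#|A| == 2) && (A \subset [set x in cyc a t b])].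

Lemma poly_proof a t b : [forall A in poly_edges a t b,
  (#|A| == 2) && (A \subset [set x in cyc a t b])].
Proof. by apply/forall_inP => A; rewrite inE => /andP[]. Qed.

Definition polygon a t b : sgraph V := SGraph (poly_proof a t b).

(** An occurrence of [s] is kept together with its root edge [xy]: edges of the polygon are then
    occurrences of subtrees ([prsP]), and its sides are occurrences of [Leaf] ([sidesP]). *)
Inductive sub : V -> tree -> V -> V -> tree -> V -> Prop :=
| sub_refl a t b : sub a t b a t b
| sub_l a t1 c t2 b x s y :
    sub a t1 c x s y -> sub a (Node t1 c t2) b x s y
| sub_r a t1 c t2 b x s y :
    sub c t2 b x s y -> sub a (Node t1 c t2) b x s y.

Lemma cyc_node a t1 c t2 b :
  cyc a (Node t1 c t2) b = a :: inner t1 ++ cyc c t2 b.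
Proof. by rewrite /cyc /= -catA. Qed.

Lemma cyc_node_l a t1 c t2 b :
  cyc a (Node t1 c t2) b = cyc a t1 c ++ inner t2 ++ [:: b].
Proof. by rewrite /cyc /= -!catA. Qed.

Lemma uniq_cyc_l a t1 c t2 b : uniq (cyc a (Node t1 c t2) b) -> uniq (cyc a t1 c).
Proof. by rewrite cyc_node_l cat_uniq => /and3P[]. Qed.

Lemma uniq_cyc_r a t1 c t2 b : uniq (cyc a (Node t1 c t2) b) -> uniq (cyc c t2 b).
Proof. by rewrite cyc_node -cat_cons cat_uniq => /and3P[]. Qed.

Lemma sub_cyc a t b x s y : sub a t b x s y ->
  exists s0 s1, cyc a t b = s0 ++ cyc x s y ++ s1.
Proof.
elim=> {a t b x s y} [a t b|a t1 c t2 b x s y _ [s0 [s1 E]]|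
  a t1 c t2 b x s y _ [s0 [s1 E]]].
- by exists [::], [::]; rewrite cats0.
- by exists s0, (s1 ++ inner t2 ++ [:: b]); rewrite cyc_node_l E -!catA.
- by exists (a :: inner t1 ++ s0), s1; rewrite cyc_node E /= -!catA.
Qed.

Lemma sub_trans a t b x s y u r v :
  sub a t b x s y -> sub x s y u r v -> sub a t b u r v.
Proof.
by move=> H; elim: H u r v => {a t b x s y} [//|a t1 c t2 b x s y _ IH|
  a t1 c t2 b x s y _ IH] u r v /IH; [apply: sub_l|apply: sub_r].
Qed.

Lemma sub_uniq a t b x s y :
  sub a t b x s y -> uniq (cyc a t b) -> uniq (cyc x s y).
Proof. by case/sub_cyc=> s0 [s1 ->]; rewrite !cat_uniq => /and3P[_ _ /and3P[]]. Qed.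

Lemma sub_prs a t b x s y :
  sub a t b x s y -> {subset prs x s y <= prs a t b}.
Proof.
elim=> {a t b x s y} [a t b p //|a t1 c t2 b x s y _ IH p /IH Hp|
  a t1 c t2 b x s y _ IH p /IH Hp] /=; by rewrite inE mem_cat Hp ?orbT.
Qed.

Lemma prs_head a t b : (a, b) \in prs a t b.
Proof. by case: t => *; rewrite inE eqxx. Qed.

Lemma prsP a t b x y :
  reflect (exists s, sub a t b x s y) ((x, y) \in prs a t b).
Proof.
apply: (iffP idP) => [|[s /sub_prs]]; last by apply; apply: prs_head.
elim: t a b => [|t1 IH1 c t2 IH2] a b /=.
  by rewrite inE => /eqP[-> ->]; exists Leaf; constructor.
rewrite inE mem_cat => /predU1P[[-> ->]|/orP[/IH1|/IH2] [s Hs]].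
- by eexists; constructor.
- by exists s; apply: sub_l.
- by exists s; apply: sub_r.
Qed.

Lemma sidesP a t b x y :
  reflect (sub a t b x Leaf y) ((x, y) \in sides a t b).
Proof.
apply: (iffP idP).
  elim: t a b => [|t1 IH1 c t2 IH2] a b /=.
    by rewrite inE => /eqP[-> ->]; constructor.
  by rewrite mem_cat => /orP[/IH1|/IH2]; [apply: sub_l|apply: sub_r].
move E: Leaf => s Hs; elim: Hs E => {a t b x s y}
 [a t b <-|a t1 c t2 b x s y _ IH /IH|a t1 c t2 b x s y _ IH /IH] /=.
- by rewrite inE.
- by rewrite mem_cat => ->.
- by rewrite mem_cat => ->; rewrite orbT.
Qed.

Lemma sides_prs a t b : {subset sides a t b <= prs a t b}.
Proof. by move=> [x y] /sidesP H; apply/prsP; exists Leaf. Qed.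

Lemma prs_cyc a t b x y : (x, y) \in prs a t b ->
  (x \in cyc a t b) /\ (y \in cyc a t b).
Proof.
by case/prsP=> s /sub_cyc[s0 [s1 ->]]; rewrite !(mem_cat, inE) !eqxx !(orbT, orTb).
Qed.

Lemma prs_neq a t b x y : uniq (cyc a t b) -> (x, y) \in prs a t b -> x != y.
Proof.
move=> U /prsP[s /sub_uniq/(_ U)] /= /andP[+ _].
by rewrite mem_cat !inE negb_or => /andP[].
Qed.

Lemma drtP a t b x y :
  ((x, y) \in drt a t b) = ((x, y) \in prs a t b) || ((y, x) \in prs a t b).
Proof.
rewrite mem_cat; congr orb; apply/mapP/idP => [[[u v] H [-> ->]] //|H].
by exists (y, x).
Qed.

Lemma drt_sym a t b x y : ((x, y) \in drt a t b) = ((y, x) \in drt a t b).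
Proof. by rewrite !drtP orbC. Qed.

Lemma drt_cyc a t b x y : (x, y) \in drt a t b ->
  (x \in cyc a t b) /\ (y \in cyc a t b).
Proof. by rewrite drtP => /orP[/prs_cyc[]|/prs_cyc[]]. Qed.

Lemma drt_neq a t b x y : uniq (cyc a t b) -> (x, y) \in drt a t b -> x != y.
Proof.
by move=> U; rewrite drtP => /orP[/(prs_neq U)|/(prs_neq U)]; rewrite // eq_sym.
Qed.

Lemma set2_eq (x y u v : V) : [set x; y] = [set u; v] ->
  (x = u /\ y = v) \/ (x = v /\ y = u).
Proof.
move=> E.
have /set2P Hx : x \in [set u; v] by rewrite -E set21.
have /set2P Hy : y \in [set u; v] by rewrite -E set22.
have /set2P Hu : u \in [set x; y] by rewrite E set21.
have /set2P Hv : v \in [set x; y] by rewrite E set22.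
case: Hx Hy Hu Hv => -> [] -> [] Hu [] Hv; subst; auto.
Qed.

Lemma edge_polyP a t b A : uniq (cyc a t b) ->
  reflect (exists x y, A = [set x; y] /\ (x, y) \in drt a t b)
          (A \in edge (polygon a t b)).
Proof.
move=> U; rewrite inE; apply: (iffP andP) => [[/mapP[[x y] H ->] _]|].
  by exists x, y; rewrite drtP H.
case=> x [y [-> H]]; have [Hx Hy] := drt_cyc H; split.
  move: H; rewrite drtP => /orP[] H; apply/mapP.
    by exists (x, y).
  by exists (y, x) => //; rewrite /pset /= setUC.
by rewrite cards2 (drt_neq U H) subUset !sub1set !in_set Hx Hy.
Qed.

Lemma adj_poly a t b x y : uniq (cyc a t b) ->
  adj (polygon a t b) x y = ((x, y) \in drt a t b).
Proof.
move=> U; rewrite /adj /=; apply/(edge_polyP _ U)/idP => [[u [v [E H]]]|H].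
  by case: (set2_eq E) => -[-> ->]; rewrite // drt_sym.
by exists x, y.
Qed.

Lemma vert_poly a t b : vert (polygon a t b) = [set x in cyc a t b].
Proof. by []. Qed.

Lemma card_vert_poly a t b : uniq (cyc a t b) ->
  #|vert (polygon a t b)| = (size (inner t)).+2.
Proof.
move=> U; rewrite vert_poly cardsE; have /card_uniqP -> := U.
by rewrite /= size_cat addn1.
Qed.

Lemma sgraph_eq (G G' : sgraph V) : vert G = vert G' -> edge G = edge G' -> G = G'.
Proof.
case: G => v e p; case: G' => v' e' p' /= Ev Ee; subst v' e'.
by congr SGraph; apply: eq_irrelevance.
Qed.

Lemma poly_eq a t b a' t' b' : uniq (cyc a t b) -> uniq (cyc a' t' b') ->
  cyc a t b =i cyc a' t' b' -> drt a t b =i drt a' t' b' ->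
  polygon a t b = polygon a' t' b'.
Proof.
move=> U U' Ec Ed; apply: sgraph_eq.
  by apply/setP=> x; rewrite !vert_poly !in_set Ec.
apply/setP=> A; apply/(edge_polyP _ U)/(edge_polyP _ U') => -[x [y [-> H]]];
by exists x, y; rewrite -?Ed // Ed.
Qed.

Lemma in_drt_node a t1 c t2 b p : p \in drt a (Node t1 c t2) b <->
  [\/ p = (a, b), p = (b, a), p \in drt a t1 c | p \in drt c t2 b].
Proof.
case: p => u v; rewrite !drtP /= !inE !mem_cat !xpair_eqE; split.
  case/orP=> /or3P[/andP[/eqP-> /eqP->]|H|H];
  by [apply: Or41|apply: Or42|apply: Or43; rewrite H ?orbT|
      apply: Or44; rewrite H ?orbT].
by case=> [[-> ->]|[-> ->]|/orP[]->|/orP[]->]; rewrite ?eqxx ?orbT.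
Qed.

Lemma drt_head a t b : (a, b) \in drt a t b.
Proof. by rewrite drtP prs_head. Qed.

(** * Changing the root edge *)

Lemma in_drt2 a t b a' t' b' p :
  (p \in drt a t b ++ drt a' t' b') = (p \in drt a t b) || (p \in drt a' t' b').
Proof. exact: mem_cat. Qed.

(** The triangle [abc] changes sides: seen from [ac] it lies beyond the root edge, with [t2] and the
    outer tree [t0] glued to its other two sides. *)
Lemma drt_step_l a t1 c t2 b t0 :
  drt a (Node t1 c t2) b ++ drt b t0 a =i drt a t1 c ++ drt c (Node t2 b t0) a.
Proof.
move=> p; rewrite !in_drt2; apply/orP/orP.
  case=> [/in_drt_node[->|->|H|H]|H].
  + by right; apply/in_drt_node; apply: Or44; rewrite drt_sym drt_head.
  + by right; apply/in_drt_node; apply: Or44; rewrite drt_head.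
  + by left.
  + by right; apply/in_drt_node; apply: Or43.
  + by right; apply/in_drt_node; apply: Or44.
case=> [H|/in_drt_node[->|->|H|H]].
+ by left; apply/in_drt_node; apply: Or43.
+ by left; apply/in_drt_node; apply: Or43; rewrite drt_sym drt_head.
+ by left; apply/in_drt_node; apply: Or43; rewrite drt_head.
+ by left; apply/in_drt_node; apply: Or44.
+ by right.
Qed.

Lemma drt_step_r a t1 c t2 b t0 :
  drt a (Node t1 c t2) b ++ drt b t0 a =i drt c t2 b ++ drt b (Node t0 a t1) c.
Proof.
move=> p; rewrite !in_drt2; apply/orP/orP.
  case=> [/in_drt_node[->|->|H|H]|H].
  + by right; apply/in_drt_node; apply: Or43; rewrite drt_sym drt_head.
  + by right; apply/in_drt_node; apply: Or43; rewrite drt_head.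
  + by right; apply/in_drt_node; apply: Or44.
  + by left.
  + by right; apply/in_drt_node; apply: Or43.
case=> [H|/in_drt_node[->|->|H|H]].
+ by left; apply/in_drt_node; apply: Or44.
+ by left; apply/in_drt_node; apply: Or44; rewrite drt_sym drt_head.
+ by left; apply/in_drt_node; apply: Or44; rewrite drt_head.
+ by right.
+ by left; apply/in_drt_node; apply: Or43.
Qed.

(* Rerooting across the edge [xy]: the triangulation [t0] fills the other side
   of the root edge [ab]. *)
Lemma sub_zip a t b x s y t0 : sub a t b x s y ->
  exists r, perm_eq (a :: inner t ++ b :: inner t0)
                    (x :: inner s ++ y :: inner r) /\
    drt a t b ++ drt b t0 a =i drt x s y ++ drt y r x.
Proof.
move=> H; elim: H t0 => {a t b x s y}.
- by move=> a t b t0; exists t0.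
- move=> a t1 c t2 b x s y _ IH t0.
  have [r [E1 E2]] := IH (Node t2 b t0).
  exists r; split; first by apply: perm_trans E1; rewrite /= -catA.
  by move=> p; rewrite -E2 drt_step_l.
- move=> a t1 c t2 b x s y _ IH t0.
  have [r [E1 E2]] := IH (Node t0 a t1).
  exists r; split.
    apply: perm_trans E1; rewrite /= -catA -cat_cons perm_catC /=.
    by rewrite -!catA.
  by move=> p; rewrite -E2 drt_step_r.
Qed.

Lemma drt_root_leaf a t b : drt a t b ++ drt b Leaf a =i drt a t b.
Proof.
move=> [u v]; rewrite in_drt2 (drtP b) !inE; apply/orP/idP=> [[//|]|H]; last by left.
by case/orP=> /eqP[-> ->]; rewrite ?drt_head // drt_sym drt_head.
Qed.

Lemma sub_drt a t b x s y : sub a t b x s y -> {subset drt x s y <= drt a t b}.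
Proof.
by move=> /sub_prs H [u v]; rewrite !drtP => /orP[] /H ->; rewrite ?orbT.
Qed.

Lemma sub_root a t b x s y : uniq (cyc a t b) -> sub a t b x s y ->
  exists r, perm_eq (cyc a t b) (x :: inner s ++ y :: inner r) /\
    drt a t b =i drt x s y ++ drt y r x.
Proof.
move=> U /(sub_zip Leaf)[r [E1 E2]]; exists r; split=> //.
by move=> p; rewrite -E2 drt_root_leaf.
Qed.

(** The chord [xy] separates: the two trees of [sub_root] share only [x] and [y], so no dart of the
    far one starts at an inner vertex of [s]. *)
Lemma sub_inner_drt a t b x s y z w : uniq (cyc a t b) -> sub a t b x s y ->
  z \in inner s -> (z, w) \in drt a t b -> (z, w) \in drt x s y.
Proof.
move=> U H Hz; have [r [E1 ->]] := sub_root U H; rewrite in_drt2.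
case/orP=> // /drt_cyc[Hz' _]; exfalso.
move: U; rewrite (perm_uniq E1) -cat_cons cat_uniq => /and3P[U1 /hasPn Hd _].
move: Hz'; rewrite /cyc -cat_cons mem_cat mem_seq1 => /orP[/Hd|/eqP E].
  by rewrite inE Hz orbT.
by move: U1; rewrite -E /= Hz.
Qed.

(** The root moves down the left spine, with an ever larger tree on its outer side, until it is the
    edge from [a] to its successor on the cycle. *)
Lemma polygon_rot1 a t b : t <> Leaf -> exists c r,
  cyc c r a = rot 1 (cyc a t b) /\ drt c r a =i drt a t b.
Proof.
have gen t0 : t <> Leaf \/ t0 <> Leaf -> exists c r, inner t ++ b :: inner t0 = c :: inner r /\
    drt a t b ++ drt b t0 a =i drt c r a.
  elim: t b t0 => [|t1 IH c t2 _] b t0 Ht.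
    exists b, t0; split=> // p; rewrite -[RHS]drt_root_leaf !in_drt2.
    by rewrite orbC.
  have [|d [r [E1 E2]]] := IH c (Node t2 b t0); first by right.
  exists d, r; split; first by rewrite -E1 /= -catA.
  by move=> p; rewrite drt_step_l E2.
move=> Ht; have [|c [r [E1 E2]]] := gen Leaf; first by left.
exists c, r; split; first by rewrite /rot /cyc /= drop0 take0 E1.
by move=> p; rewrite -E2 drt_root_leaf.
Qed.

Lemma polygon_rot n a t b : t <> Leaf -> exists a' t' b',
  cyc a' t' b' = rot n (cyc a t b) /\ drt a' t' b' =i drt a t b.
Proof.
have red m : m < size (cyc a t b) -> t <> Leaf -> exists a' t' b',
  cyc a' t' b' = rot m (cyc a t b) /\ drt a' t' b' =i drt a t b.
  elim: m => [|m IH] Hm Ht; first by exists a, t, b; rewrite rot0.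
  have [a' [t' [b' [E1 E2]]]] := IH (ltnW Hm) Ht.
  have [|c [r [E3 E4]]] := @polygon_rot1 a' t' b'.
    move=> E; have := congr1 size E1; rewrite size_rot E /= !size_cat /=.
    by case: (t) Ht => [/(_ erefl)|t1 c t2 _] //=; rewrite size_cat /= !addnS.
  exists c, r, a'; split; last by move=> p; rewrite E4 E2.
  by rewrite E3 E1 -rotS // ltnW.
move=> Ht; have [Hn|Hn] := ltnP n (size (cyc a t b)); first exact: red.
by exists a, t, b; rewrite rot_oversize.
Qed.

End Trees.

Arguments Leaf {V}.

(** * The standard embedding of a triangulated polygon *)

Section Next.
Variable T : eqType.
Implicit Types (x y : T) (p s : seq T).

Lemma next_mid p1 x y p2 : uniq (p1 ++ x :: y :: p2) ->
  next (p1 ++ x :: y :: p2) x = y.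
Proof.
move=> U; rewrite next_nth mem_cat mem_head orbT.
have Hx : x \notin p1.
  by move: U; rewrite cat_uniq => /and3P[_ /hasPn/(_ x)]; rewrite mem_head => ->.
rewrite index_cat (negPf Hx) /= eqxx addn0.
case: p1 {U Hx} => [//|z p1] /=.
by rewrite nth_cat ltnNge leqnSn /= subSnn.
Qed.

Lemma next_last y p x : uniq (y :: rcons p x) -> next (y :: rcons p x) x = y.
Proof.
move=> U; rewrite next_nth inE mem_rcons mem_head orbT.
have Hx : x \notin y :: p.
  by move: U; rewrite -rcons_cons rcons_uniq => /andP[].
have -> : index x (y :: rcons p x) = (size p).+1.
  by rewrite -rcons_cons -cats1 index_cat (negPf Hx) /= eqxx addn0.
by rewrite nth_default // size_rcons.
Qed.

Lemma filter_rot (P : pred T) n s :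
  exists m, filter P (rot n s) = rot m (filter P s).
Proof.
exists (size (filter P (take n s))).
by rewrite -{3}[s](cat_take_drop n) !filter_cat rot_size_cat.
Qed.

Definition arcs s := zip s (rot 1 s).

Lemma arcsE s : uniq s -> arcs s = [seq (x, next s x) | x <- s].
Proof.
case: s => // y p U; apply: (@eq_from_nth _ (y, y)).
  by rewrite size_zip size_map size_rot minnn.
rewrite size_zip size_rot minnn => i Hi.
rewrite nth_zip ?size_rot // (nth_map y) //; congr pair.
rewrite next_nth mem_nth // index_uniq // rot1_cons nth_rcons.
have [Hip|Hip] := ltnP i (size p); first by [].
by rewrite nth_default // if_same.
Qed.

Lemma fcycle_set (U : finType) (f : U -> U) (p : seq U) (x : U) : fcycle f p -> uniq p ->
  x \in p -> [set y | fconnect f x y] = [set y in p].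
Proof.
move=> Cf Up Hx; apply/setP=> y; rewrite !inE fconnect_orbit.
by rewrite (fingraph.orbitE Cf) // mem_rot.
Qed.

End Next.

(** * Faces as cycles of darts *)

Section Faces.

Variables (V : finType) (G : sgraph V) (rho : {perm V * V}).

(** Faces are orbits, so cycles of [face_next] that use every dart exactly once are all of them; the
    second claim allows them to be counted for Euler's formula. *)
Lemma faces_cycles (Fs : seq (seq (V * V))) :
  {in Fs, forall f, fcycle (face_next rho) f} ->
  uniq (flatten Fs) -> flatten Fs =i darts G -> [::] \notin Fs ->
  faces G rho =i [seq [set x in f] | f <- Fs] /\
  uniq [seq [set x in f] | f <- Fs].
Proof.
move=> Hc U HD Hn.
have sub_uniq f : f \in Fs -> uniq f.
  elim: (Fs) U => //= h F IH; rewrite cat_uniq => /and3P[Uh _ UF].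
  by rewrite inE => /predU1P[->|/(IH UF)].
split.
  move=> A; apply/imsetP/mapP => [[d Hd ->]|[f Hf ->]].
    have /flattenP[f Hf Hdf] : d \in flatten Fs by rewrite HD.
    by exists f => //; apply: fcycle_set; auto.
  case E: f Hf => [|d f'] Hf; first by rewrite Hf in Hn.
  rewrite -E in Hf *; have Hd : d \in f by rewrite E mem_head.
  exists d; first by rewrite -HD; apply/flattenP; exists f.
  by apply/esym/fcycle_set; auto.
rewrite map_inj_in_uniq; last first.
  move=> f g Hf Hg E; case Ef: f Hf => [|d f'] Hf; first by rewrite Hf in Hn.
  rewrite -Ef in Hf *.
  have Hd : d \in g by have /setP/(_ d) := E; rewrite !inE Ef mem_head => <-.
  have : d \in f by rewrite Ef mem_head.
  apply: contraTeq => Nfg.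
  elim: (Fs) U Hf Hg => //= h Fs' IH; rewrite cat_uniq !inE.
  case/and3P=> Uh /hasPn Hh UF /predU1P[Efh|Hf] /predU1P[Eg|Hg].
  - by rewrite Efh Eg eqxx in Nfg.
  - by rewrite Efh; apply: Hh; apply/flattenP; exists g.
  - apply/negP=> Hdf; suff: d \notin h by rewrite -Eg Hd.
    by apply: Hh; apply/flattenP; exists f.
  - exact: IH.
elim: (Fs) U Hn => //= h Fs' IH; rewrite cat_uniq inE negb_or.
case/and3P=> Uh /hasPn Hh UF /andP[Nh Hn]; rewrite IH // andbT.
apply/negP=> HF; case E: h Nh => [|d h'] // _.
suff: d \notin h by rewrite E mem_head.
by apply: Hh; apply/flattenP; exists h => //; rewrite E mem_head.
Qed.

End Faces.

(** * The darts of a polygon, sorted by faces *)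

Section Embed.

Variable V : finType.
Implicit Types (t : tree V) (a b c x y z : V).

(** Triangles are traversed against the direction of the outer cycle, because the outer face takes
    the darts from each vertex to its successor. *)
Fixpoint tris a t b : seq (seq (V * V)) :=
  if t is Node t1 c t2
  then [:: (c, a); (a, b); (b, c)] :: tris a t1 c ++ tris c t2 b else [::].

Lemma sides_zip a t b : sides a t b = zip (a :: inner t) (inner t ++ [:: b]).
Proof.
elim: t a b => //= t1 IH1 c t2 IH2 a b.
rewrite IH1 IH2 -zip_cat; last by rewrite size_cat addn1.
by rewrite -!catA.
Qed.

Lemma arcs_cyc a t b : arcs (cyc a t b) = rcons (sides a t b) (b, a).
Proof.
rewrite /arcs /cyc rot1_cons sides_zip -!cats1 -(cat_cons a) zip_cat //.
by rewrite /= size_cat addn1.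
Qed.

(** Every dart lies on one face. In the induction the darts [(c, a)] and [(b, c)] of the root
    triangle close the outer cycles of the two subpolygons. *)
Lemma tri_darts_perm a t b :
  perm_eq (flatten (tris a t b) ++ arcs (cyc a t b)) (drt a t b).
Proof.
rewrite arcs_cyc -cats1.
elim: t a b => [|t1 IH1 c t2 IH2] a b //=.
rewrite flatten_cat.
apply: (@perm_trans _ ([:: (a, b); (b, a)] ++ ((flatten (tris a t1 c) ++ sides a t1 c ++ [:: (c, a)]) ++ (flatten (tris c t2 b) ++ sides c t2 b ++ [:: (b, c)])))).
  by apply/seq.permP => P /=; rewrite !(count_cat, =^~ cat_cons) /=; lia.
apply: (@perm_trans _ ([:: (a, b); (b, a)] ++ (drt a t1 c ++ drt c t2 b))).
  by rewrite perm_cat2l perm_cat.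
by apply/seq.permP => P; rewrite /drt /= !map_cat !(count_cat, map_cat) /= !count_cat /rev_dart /=; lia.
Qed.

(** The first entry of a pair precedes the second one along [cyc a t b]. *)
Lemma prs_asym a t b x y : uniq (cyc a t b) ->
  (x, y) \in prs a t b -> (y, x) \notin prs a t b.
Proof.
have ord u v : uniq (cyc a t b) -> (u, v) \in prs a t b ->
    index u (cyc a t b) < index v (cyc a t b).
  move=> U /prsP[s /sub_cyc[s0 [s1 E]]]; move: U; rewrite E.
  rewrite cat_uniq => /and3P[_ /hasPn H]; rewrite cat_uniq => /and3P[U _ _].
  have Hu : u \in cyc u s v by rewrite mem_head.
  have Hv : v \in cyc u s v by rewrite /cyc inE mem_cat mem_head !orbT.
  rewrite !index_cat Hu Hv (negPf (H u _)) ?mem_cat ?Hu //.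
  rewrite (negPf (H v _)) ?mem_cat ?Hv // ltn_add2l.
  move: U; rewrite /cyc /= eqxx => /andP[].
  by rewrite mem_cat inE negb_or => /andP[_ /negPf->].
move=> U H; apply/negP=> H'; have := ord _ _ U H; have := ord _ _ U H'.
by move=> /ltnW; rewrite leqNgt => /negP.
Qed.

Lemma prs_uniq a t b : uniq (cyc a t b) -> uniq (prs a t b).
Proof.
elim: t a b => [//|t1 IH1 c t2 IH2] a b U.
have U1 := uniq_cyc_l U; have U2 := uniq_cyc_r U.
rewrite /= cat_uniq IH1 // IH2 // andbT mem_cat negb_or -andbA; apply/and3P; split.
- apply/negP=> /prs_cyc[_].
  move: U; rewrite cyc_node_l cat_uniq => /and3P[_ /hasPn/(_ b) H _].
  by apply/negP/H; rewrite mem_cat inE eqxx orbT.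
- apply/negP=> /prs_cyc[].
  move: U; rewrite cyc_node -cat_cons cat_uniq => /and3P[_ /hasPn H _] Ha.
  by have := H _ Ha; rewrite mem_head.
- apply/hasPn=> -[x y] H; apply/negP=> H'.
  have [Hx Hy] := prs_cyc H; have [Hx' Hy'] := prs_cyc H'.
  have aux w : w \in cyc c t2 b -> w \in cyc a t1 c -> w = c.
    move=> H1; rewrite /cyc -cat_cons mem_cat mem_seq1 => /orP[H2|/eqP//].
    move: U; rewrite cyc_node -cat_cons cat_uniq => /and3P[_ /hasPn/(_ w H1)].
    by rewrite /= H2.
  by have := prs_neq U2 H; rewrite (aux x) // (aux y) // eqxx.
Qed.

Lemma drt_uniq a t b : uniq (cyc a t b) -> uniq (drt a t b).
Proof.
move=> U; rewrite cat_uniq prs_uniq //=; apply/andP; split; last first.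
  by rewrite map_inj_uniq ?prs_uniq // => -[x y] [u v] [-> ->].
by apply/hasPn=> _ /mapP[[x y] H ->]; apply: prs_asym.
Qed.

Lemma size_prs a t b : size (prs a t b) = (size (inner t)).*2.+1.
Proof.
elim: t a b => //= t1 IH1 c t2 IH2 a b; rewrite !size_cat IH1 IH2 /=; lia.
Qed.

Lemma size_tris a t b : size (tris a t b) = size (inner t).
Proof.
by elim: t a b => //= t1 IH1 c t2 IH2 a b; rewrite !size_cat IH1 IH2 /= addnS.
Qed.

Lemma card_edge_poly a t b : uniq (cyc a t b) ->
  #|edge (polygon a t b)| = (size (inner t)).*2.+1.
Proof.
move=> U; rewrite -(size_prs a t b).
have Ui : uniq (map (@pset V) (prs a t b)).
  rewrite map_inj_in_uniq ?prs_uniq // => -[x y] [u v] H1 H2 /set2_eq[[/= -> ->]//|[/= E1 E2]].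
  by have := prs_asym U H1; rewrite E1 E2 H2.
rewrite -(size_map (@pset V)); move/card_uniqP: Ui => <-.
apply: eq_card => A; apply/(edge_polyP _ U)/mapP => [[x [y [-> ]]]|[[x y] H ->]].
  by rewrite drtP => /orP[] H; [exists (x, y)|exists (y, x)]; rewrite // /pset setUC.
by exists x, y; rewrite drtP H.
Qed.

Lemma connected_path (G : sgraph V) (s : seq V) :
  sorted (adj G) s -> connected_on G [set x in s].
Proof.
move=> Hs; apply/forall_inP=> x Hx; apply/forall_inP=> y Hy.
set e := [rel _ _ | _]; rewrite inE in Hx; rewrite inE in Hy.
have es : connect_sym e.
  by apply: sym_connect_sym => u v /=; rewrite /adj /= setUC andbCA.
have {}Hs : sorted e s.
  apply: (sub_in_sorted (P := mem s)) Hs; last exact/allP.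
  by move=> u v Hu Hv Huv; rewrite /= !in_set; apply/and3P; split.
have [z [s' Es]] : exists z s', s = z :: s'.
  by case: (s) Hx => // z s'; exists z, s'.
have H w : w \in s -> connect e z w.
  by rewrite Es; apply: path_connect; move: Hs; rewrite Es.
by apply: connect_trans (H y Hy); rewrite es H.
Qed.

(** * The rotation system that follows the outer cycle *)

Section Rotation.

Variables (t : tree V) (a b : V).
Hypotheses (U : uniq (cyc a t b)) (Ht : t <> Leaf).
Let G := polygon a t b.
Let s := cyc a t b.

(* The standard embedding turns around every vertex in the order of the outer
   cycle. *)
Definition nbrs x := [seq y <- cyc a t b | adj (polygon a t b) x y].

Definition rot_fun (d : V * V) :=
  if adj G d.1 d.2 then (d.1, next (nbrs d.1) d.2) else d.

Lemma mem_nbrs x y : (y \in nbrs x) = adj G x y.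
Proof.
rewrite mem_filter andb_idr // adj_poly // => /drt_cyc[_ //].
Qed.

Lemma uniq_nbrs x : uniq (nbrs x). Proof. exact: filter_uniq. Qed.

Lemma adj_next x y : adj G x (next (nbrs x) y) = adj G x y.
Proof. by rewrite -!mem_nbrs mem_next. Qed.

Lemma rot_fun_inj : injective rot_fun.
Proof.
move=> [x y] [u v]; rewrite /rot_fun /=.
case: ifP => H1; case: ifP => H2 // [E1 E2].
- by subst u; congr pair; apply: (can_inj (prev_next (uniq_nbrs x))).
- by subst u v; rewrite adj_next H1 in H2.
- by subst u y; rewrite adj_next H2 in H1.
Qed.

Definition rotation := perm rot_fun_inj.

Lemma rotationE x y : adj G x y -> rotation (x, y) = (x, next (nbrs x) y).
Proof. by rewrite permE /rot_fun /= => ->. Qed.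

Lemma adjC x y : adj G x y = adj G y x.
Proof. by rewrite /adj /= setUC. Qed.

Lemma face_nextE x y : adj G x y ->
  face_next rotation (x, y) = (y, next (nbrs y) x).
Proof. by rewrite adjC => H; rewrite /face_next /rev_dart /= rotationE. Qed.

Lemma darts_poly : darts G =i drt a t b.
Proof. by move=> [x y]; rewrite inE adj_poly. Qed.

Lemma rotation_poly : rotation_system G rotation.
Proof.
move=> [x y]; rewrite inE /= => Hxy.
pose p := [seq (x, z) | z <- nbrs x].
have Up : uniq p by rewrite map_inj_uniq ?uniq_nbrs // => u v [].
have Cp : fcycle rotation p.
  rewrite cycle_map; apply: (sub_in_cycle (P := mem (nbrs x)) (e := frel (next (nbrs x)))).
  - move=> u v Hu Hv /eqP <-; apply/eqP; apply: rotationE.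
    by rewrite -mem_nbrs.
  - exact/allP.
  - exact/cycle_next/uniq_nbrs.
have Hp : (x, y) \in p by apply/mapP; exists y => //; rewrite mem_nbrs.
have := fcycle_set Cp Up Hp => /setP E.
apply/setP=> d; have := E d; rewrite !inE => E'.
transitivity (d \in p); last first.
  apply/mapP/andP=> [[z]|[H1 /eqP H2]]; first by rewrite mem_nbrs => Hz ->.
  by exists d.2; rewrite ?mem_nbrs -H2 //; case: (d).
rewrite -E'; apply/porbitP/idP => [[i ->]|/iter_findex <-].
  by rewrite permX fconnect_iter.
by exists (findex rotation (x, y) d); rewrite permX.
Qed.

Lemma arcs_adj x y : (x, y) \in arcs s -> adj G x y.
Proof.
rewrite adj_poly //; rewrite -(perm_mem (tri_darts_perm a t b)) mem_cat.
by move=> ->; rewrite orbT.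
Qed.

Lemma sorted_cyc : sorted (adj G) s.
Proof.
have path_zip (e : rel V) x p : path e x p = all (fun d => e d.1 d.2) (zip (x :: p) p).
  by elim: p x => //= y p IH x; rewrite IH.
rewrite /s /cyc /= path_zip; apply/allP=> -[x y] /= H; apply: arcs_adj.
rewrite arcs_cyc mem_rcons inE sides_zip; apply/orP; right.
move: H; rewrite -[X in zip _ X]cats0 -cat_cons zip_cat ?cats0 //.
by rewrite /= size_cat addn1.
Qed.

Lemma connected_poly : connected_on G (vert G).
Proof. exact/connected_path/sorted_cyc. Qed.

(** Between the predecessor [x] and the successor [z] of [y] the cycle has only [y] itself, which is
    not its own neighbour; so around [y] the turn leads from [x] to [z]. *)
Lemma fcycle_arcs : fcycle (face_next rotation) (arcs s).
Proof.
rewrite arcsE // cycle_map.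
apply: (sub_in_cycle (P := mem s) (e := frel (next s))); last exact/cycle_next.
- move=> x _ Hx _ /eqP <-; apply/eqP.
  change (face_next rotation (x, next s x) = (next s x, next s (next s x))).
  have [n r Er] := rot_to Hx.
  have Ur : uniq (x :: r) by rewrite -Er rot_uniq.
  have A z : z \in s -> adj G z (next s z).
    by move=> Hz; apply: arcs_adj; rewrite arcsE //; apply/mapP; exists z.
  rewrite face_nextE ?A //; congr pair.
  case: r Er Ur => [|y [|z r]] Er Ur.
  + by have := congr1 size Er; rewrite size_rot /= size_cat addn1.
  + have := congr1 size Er; rewrite size_rot /= size_cat addn1.
    by case: (t) Ht => //= t1 c t2 _; rewrite size_cat addnS.
  have Ns w : next s w = next (x :: y :: z :: r) w by rewrite -Er next_rot.
  have Nx : next s x = y by rewrite Ns /= eqxx.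
  have Hy : y \in s by rewrite -(mem_rot n) Er !inE eqxx orbT.
  have Ny : next s y = z by rewrite Ns (@next_mid _ [:: x]).
  rewrite Nx Ny /nbrs.
  have [m Em] := filter_rot (adj G y) n (cyc a t b).
  rewrite -(next_rot m) ?uniq_nbrs // -/s -Em Er /=.
  rewrite adjC -{1}Nx A // -[in adj G y z]Ny A //.
  have -> : adj G y y = false.
    by apply/negP; rewrite adj_poly // => /(drt_neq U); rewrite eqxx.
  by rewrite /= eqxx.
- exact/allP.
Qed.

(** At no corner of a triangle [xcy] does the turn skip a neighbour: the chords keep [x] from the
    inside of [t2], [y] from the inside of [t1], and [c] from everything beyond [xy]. *)
Lemma fcycle_tris f : f \in tris a t b -> fcycle (face_next rotation) f.
Proof.
have gen a' t' b' : sub a t b a' t' b' -> f \in tris a' t' b' -> exists x t1 c t2 y,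
    sub a t b x (Node t1 c t2) y /\ f = [:: (c, x); (x, y); (y, c)].
  elim: t' a' b' => //= t1 IH1 c t2 IH2 a' b' Hs.
  rewrite inE mem_cat => /predU1P[->|/orP[]]; first by exists a', t1, c, t2, b'.
  - by apply: IH1; apply: sub_trans Hs _; apply: sub_l; constructor.
  - by apply: IH2; apply: sub_trans Hs _; apply: sub_r; constructor.
move/(gen a t b (sub_refl a t b))=> [x [t1 [c [t2 [y [Hs ->]]]]]] {gen f}.
have [s0 [s1 Es]] := sub_cyc Hs.
have [Hxy Hyx] : (x, y) \in drt a t b /\ (y, x) \in drt a t b.
  by rewrite (drt_sym _ _ _ y) !(sub_drt Hs) ?drt_head.
have [Hxc Hcy] : (x, c) \in drt a t b /\ (c, y) \in drt a t b.
  split; apply: (sub_drt Hs); apply/in_drt_node; [apply: Or43|apply: Or44];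
  exact: drt_head.
have Hcx : (c, x) \in drt a t b by rewrite drt_sym.
have Hyc : (y, c) \in drt a t b by rewrite drt_sym.
have Uxy := sub_uniq Hs U.
have none P l : {in l, forall z : V, ~~ P z} -> filter P l = [::].
  by move=> H; apply/eqP; rewrite -(negbK (_ == _)) -has_filter; apply/hasPn.
have Dx : filter (adj G x) (inner t2) = [::].
  apply: none => z Hz; apply/negP; rewrite adjC adj_poly // => Hzx.
  have Hs2 := sub_trans Hs (sub_r x t1 (sub_refl c t2 y)).
  have [_ Hx] := drt_cyc (sub_inner_drt U Hs2 Hz Hzx).
  move: Uxy; rewrite cyc_node -cat_cons cat_uniq => /and3P[_ /hasPn/(_ x Hx)].
  by rewrite mem_head.
have Dy : filter (adj G y) (inner t1) = [::].
  apply: none => z Hz; apply/negP; rewrite adjC adj_poly // => Hzy.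
  have Hs1 := sub_trans Hs (sub_l t2 y (sub_refl x t1 c)).
  have [_ Hy] := drt_cyc (sub_inner_drt U Hs1 Hz Hzy).
  move: Uxy; rewrite cyc_node_l cat_uniq => /and3P[_ /hasPn/(_ y) H _].
  by move: H; rewrite mem_cat mem_head orbT Hy => /(_ isT).
have Dc z : adj G c z -> z \in cyc x (Node t1 c t2) y.
  rewrite adj_poly // => Hz; have Hc : c \in inner (Node t1 c t2).
    by rewrite mem_cat mem_head orbT.
  by have [] := drt_cyc (sub_inner_drt U Hs Hc Hz).
have [Ds0 Ds1] : filter (adj G c) s0 = [::] /\ filter (adj G c) s1 = [::].
  split; apply: none => z Hz; apply/negP => /Dc Hzc; move: U; rewrite Es cat_uniq.
    by move=> /and3P[_ /hasPn/(_ z)]; rewrite mem_cat Hzc Hz => /(_ isT).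
  by rewrite cat_uniq => /and3P[_ _ /and3P[_ /hasPn/(_ z Hz)]]; rewrite /= Hzc.
have irr z : adj G z z = false.
  by apply/negP; rewrite adj_poly // => /(drt_neq U); rewrite eqxx.
have Axc : adj G x c by rewrite adj_poly.
have Axy : adj G x y by rewrite adj_poly.
have Acy : adj G c y by rewrite adj_poly.
have Acx : adj G c x by rewrite adjC.
have Ayc : adj G y c by rewrite adjC.
have Ayx : adj G y x by rewrite adjC.
have Ex : cyc a t b = (s0 ++ x :: inner t1) ++ c :: inner t2 ++ y :: s1.
  by rewrite Es cyc_node /cyc /= -!catA /= -?catA.
have Ey : cyc a t b = s0 ++ x :: inner t1 ++ c :: inner t2 ++ y :: s1.
  by rewrite Ex -catA.
have fc (P : pred V) z l : filter P (z :: l) = if P z then z :: filter P l else filter P l.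
  by [].
have Nx : nbrs x = filter (adj G x) (s0 ++ x :: inner t1) ++ c :: y :: filter (adj G x) s1.
  by rewrite /nbrs -/G Ex filter_cat fc Axc (filter_cat _ (inner t2)) Dx cat0s fc Axy.
have Ny : nbrs y = filter (adj G y) s0 ++ x :: c :: filter (adj G y) (inner t2 ++ y :: s1).
  by rewrite /nbrs -/G Ey filter_cat fc Ayx (filter_cat _ (inner t1)) Dy cat0s fc Ayc.
have Nc : nbrs c = x :: rcons (filter (adj G c) (inner t1 ++ c :: inner t2)) y.
  rewrite /nbrs -/G Ey filter_cat Ds0 cat0s fc Acx -cats1 -!cat_cons catA.
  by rewrite (filter_cat _ (inner t1 ++ _)) fc Acy Ds1.
rewrite /= !face_nextE // andbT; apply/and3P; split; apply/eqP; congr pair.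
- by rewrite Nx; apply: next_mid; rewrite -Nx uniq_nbrs.
- by rewrite Ny; apply: next_mid; rewrite -Ny uniq_nbrs.
- by rewrite Nc; apply: next_last; rewrite -Nc uniq_nbrs.
Qed.

Definition tri_sets a t b : seq {set V * V} := [seq [set x in f] | f <- tris a t b].

Lemma standard_poly : exists o,
  [/\ standard_embedding G rotation o,
      interior_faces G rotation o =i tri_sets a t b & uniq (tri_sets a t b)].
Proof.
have PD := tri_darts_perm a t b.
have [] := @faces_cycles V G rotation (arcs s :: tris a t b).
- by move=> f; rewrite inE => /predU1P[->|]; [apply: fcycle_arcs|apply: fcycle_tris].
- by rewrite /= (perm_uniq (permEl (perm_catC _ _))) (perm_uniq PD) drt_uniq.
- by move=> d; rewrite /= (perm_mem (permEl (perm_catC _ _))) (perm_mem PD) darts_poly.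
- rewrite inE negb_or; apply/andP; split; first by rewrite arcs_cyc -cats1; case: (sides _ _ _).
  elim: (t) (a) (b) => [//|t1 IH1 c t2 IH2] x y /=.
  by rewrite inE mem_cat !negb_or IH1 IH2.
rewrite /= -/(tri_sets a t b) => Ef /andP[No Ut].
set o := [set x in arcs s] in Ef No *.
have Hin : interior_faces G rotation o =i tri_sets a t b.
  move=> f; rewrite in_setD1 Ef inE.
  by have [->|] := eqVneq f o; rewrite ?(negPf No).
exists o; split=> //; split.
- split; [exact: rotation_poly|exact: connected_poly|].
  rewrite card_vert_poly // card_edge_poly //.
  have -> : #|faces G rotation| = (size (inner t)).+1.
    rewrite (eq_card Ef) -(size_tris a t b) -(size_map (fun f => [set x in f])).
    by apply/card_uniqP; rewrite /= No.
  lia.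
- by rewrite Ef mem_head.
- move=> d d'; rewrite !inE arcsE // => /mapP[x _ ->] /mapP[y _ ->] /= -> //.
- apply/setP=> x; rewrite vert_poly [RHS]inE; apply/imsetP/idP => [[d]|Hx].
    by rewrite inE arcsE // => /mapP[y Hy ->] ->.
  by exists (x, next s x) => //; rewrite inE arcsE //; apply/mapP; exists x.
- move=> f; rewrite -/(interior_faces G rotation o) Hin => /mapP[g Hg ->].
  have Ug : uniq g.
    have : uniq (flatten (tris a t b)).
      have := drt_uniq U; rewrite -(perm_uniq PD) cat_uniq => /and3P[] //.
    elim: (tris a t b) Hg => //= h F IH; rewrite cat_uniq inE => Hg /and3P[Uh _ UF].
    by case/predU1P: Hg => [->|/IH]; auto.
  rewrite cardsE; have /card_uniqP -> := Ug.
  elim: (t) (a) (b) Hg => //= t1 IH1 c t2 IH2 x y.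
  by rewrite inE mem_cat => /predU1P[->|/orP[/IH1|/IH2]].
Qed.

Lemma maxouter_poly : maximal_outerplanar G.
Proof.
have [o [So _ _]] := standard_poly; split; last by exists rotation, o.
by rewrite card_vert_poly //; case: (t) Ht => //= t1 c t2 _; rewrite size_cat addnS.
Qed.

End Rotation.

End Embed.

(** * Outerplanar paths and cutting edges *)

Section Linear.

Variable V : finType.
Implicit Types (t : tree V) (a b c x y z : V) (G : sgraph V) (f : {set V * V}).

(** The nodes of [t] form the dual tree; the condition says that it is a path with the root triangle
    at one end. *)
Fixpoint linear t : bool :=
  if t is Node t1 c t2 then [&& is_leaf t1 || is_leaf t2, linear t1 & linear t2]
  else true.

Lemma incident_tri a t b f (A : {set V}) : f \in tri_sets a t b -> incident A f ->
  exists2 d, d \in drt a t b & pset d = A.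
Proof.
move=> Hf /exists_inP[d Hd /eqP E]; exists d => //.
move: Hf => /mapP[g Hg Ef]; rewrite Ef inE in Hd.
rewrite -(perm_mem (tri_darts_perm a t b)) mem_cat; apply/orP; left.
by apply/flattenP; exists g.
Qed.

Lemma incident_tri_cyc a t b f A : f \in tri_sets a t b -> incident A f ->
  A \subset [set x in cyc a t b].
Proof.
move=> Hf /(incident_tri Hf)[[x y] Hd <-]; have [Hx Hy] := drt_cyc Hd.
by rewrite subUset !sub1set !in_set Hx Hy.
Qed.

Lemma share_edgeC G f f' : share_edge G f f' = share_edge G f' f.
Proof. by apply: eq_existsb => A; rewrite [incident A f && _]andbC. Qed.

Lemma incident_root a t1 c t2 b A :
  incident A (head set0 (tri_sets a (Node t1 c t2) b)) =
  [|| A == [set a; c], A == [set a; b] | A == [set b; c]].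
Proof.
apply/exists_inP/idP => [[d]|]; rewrite /= ?inE.
  by case/or3P=> /eqP-> /= /eqP <-; rewrite ?eqxx ?orbT // setUC eqxx.
case/or3P=> /eqP->.
- by exists (c, a); rewrite ?inE ?eqxx //= setUC.
- by exists (a, b); rewrite ?inE ?eqxx ?orbT.
- by exists (b, c); rewrite ?inE ?eqxx ?orbT.
Qed.

(** The face [f] touches the polygon [p t q] only along its root edge, and only the first triangle
    of the list contains both [p] and [q]. *)
Lemma share_child G p t q f j : uniq (cyc p t q) -> [set p; q] \in edge G ->
  incident [set p; q] f ->
  (forall A, incident A f -> A \subset [set x in cyc p t q] -> A = [set p; q]) ->
  j < size (tri_sets p t q) ->
  share_edge G f (nth set0 (tri_sets p t q) j) = (j == 0).
Proof.
move=> U Hpq If If'; case: t U If' => [//|s1 e s2] U If'.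
case: j => [_|j Hj].
  apply/exists_inP; exists [set p; q] => //; rewrite If /=.
  by rewrite (incident_root p s1 e s2 q) eqxx orbT.
apply/negbTE/exists_inP => -[A _ /andP[HA HI]].
have HI' : incident A (nth set0 (tri_sets p s1 e ++ tri_sets e s2 q) j).
  by move: HI; rewrite /tri_sets /= map_cat.
have Hf : nth set0 (tri_sets p s1 e ++ tri_sets e s2 q) j \in tri_sets p s1 e ++ tri_sets e s2 q.
  by apply: mem_nth; move: Hj; rewrite /tri_sets /= map_cat.
have [Hp Hq] : p \notin cyc e s2 q /\ q \notin cyc p s1 e.
  split; apply/negP=> H; move: U.
    by rewrite cyc_node -cat_cons cat_uniq => /and3P[_ /hasPn/(_ p H)]; rewrite /= mem_head.
  rewrite cyc_node_l cat_uniq => /and3P[_ /hasPn/(_ q)].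
  by rewrite mem_cat mem_head orbT H => /(_ isT).
move: Hf; rewrite mem_cat => /orP[] Hf; have HS := incident_tri_cyc Hf HI'.
  have EA : A = [set p; q].
    apply: If' => //; apply: subset_trans HS _; apply/subsetP=> x; rewrite !in_set cyc_node_l.
    by rewrite mem_cat => ->.
  by move: HS; rewrite EA subUset !sub1set !in_set (negPf Hq) andbF.
have EA : A = [set p; q].
  apply: If' => //; apply: subset_trans HS _; apply/subsetP=> x; rewrite !in_set cyc_node.
  by rewrite -cat_cons mem_cat orbC => ->.
by move: HS; rewrite EA subUset !sub1set !in_set (negPf Hp).
Qed.

(** The list is in preorder. One of the two subtrees is a leaf, so the root triangle is followed
    directly by the list of the other one, to which [share_child] applies. *)
Lemma share_tri G a t b i j : uniq (cyc a t b) -> linear t ->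
  (forall d, d \in drt a t b -> pset d \in edge G) ->
  i < j -> j < size (tri_sets a t b) ->
  share_edge G (nth set0 (tri_sets a t b) i) (nth set0 (tri_sets a t b) j)
  = (j == i.+1).
Proof.
elim: t a b i j => [//|t1 IH1 c t2 IH2] a b i j U /and3P[L12 L1 L2] HG.
have U1 := uniq_cyc_l U; have U2 := uniq_cyc_r U.
have HG1 d : d \in drt a t1 c -> pset d \in edge G.
  by move=> H; apply: HG; apply/in_drt_node; apply: Or43.
have HG2 d : d \in drt c t2 b -> pset d \in edge G.
  by move=> H; apply: HG; apply/in_drt_node; apply: Or44.
have Eab : {subset [:: a; b; c] <= cyc a (Node t1 c t2) b}.
  move=> x; rewrite !inE mem_cat mem_cat !inE.
  by case/or3P=> /eqP ->; rewrite eqxx ?orbT.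
have Et : tri_sets a (Node t1 c t2) b =
    head set0 (tri_sets a (Node t1 c t2) b) :: tri_sets a t1 c ++ tri_sets c t2 b.
  by rewrite /tri_sets /= map_cat.
have [Na Nb] : a \notin cyc c t2 b /\ b \notin cyc a t1 c.
  split; apply/negP=> H; move: U.
    by rewrite cyc_node -cat_cons cat_uniq => /and3P[_ /hasPn/(_ a H)]; rewrite /= mem_head.
  rewrite cyc_node_l cat_uniq => /and3P[_ /hasPn/(_ b)].
  by rewrite mem_cat mem_head orbT H => /(_ isT).
rewrite Et; set f0 := head _ _ => {Et}.
have If0 A := incident_root a t1 c t2 b A.
rewrite -/f0 in If0.
case: j => // j; case: i => [_|i].
  rewrite [size _]/= ltnS eqSS [nth _ _ 0]/= [nth _ _ j.+1]/=.
  case/orP: L12 => [|] L.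
    have -> /= : tri_sets a t1 c = [::] by case: (t1) L.
    apply: share_child => //; first exact: (HG2 _ (drt_head _ _ _)).
      by rewrite If0 (setUC [set c]) eqxx !orbT.
    move=> A; rewrite If0 => /or3P[]/eqP->; rewrite ?subUset ?sub1set ?in_set ?(negPf Na) //.
    by rewrite setUC.
  have -> : tri_sets c t2 b = [::] by case: (t2) L.
  rewrite cats0; apply: share_child => //; first exact: (HG1 _ (drt_head _ _ _)).
    by rewrite If0 eqxx.
  by move=> A; rewrite If0 => /or3P[]/eqP->; rewrite ?subUset ?sub1set ?in_set ?(negPf Nb) ?andbF.
rewrite !ltnS eqSS [nth _ _ i.+1]/= [nth _ _ j.+1]/=.
case/orP: L12 => [|] L.
  have -> /= : tri_sets a t1 c = [::] by case: (t1) L.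
  exact: IH2.
have -> : tri_sets c t2 b = [::] by case: (t2) L.
rewrite cats0; exact: IH1.
Qed.

Lemma dual_path_tri a t b rho o : uniq (cyc a t b) -> linear t ->
  interior_faces (polygon a t b) rho o =i tri_sets a t b -> uniq (tri_sets a t b) ->
  dual_path (polygon a t b) rho o (tri_sets a t b).
Proof.
move=> U L Hi Ut; split=> // i j Hi' Hj' Nij.
have HG d : d \in drt a t b -> pset d \in edge (polygon a t b).
  by case: d => x y H; apply/edge_polyP => //; exists x, y.
case: (ltngtP i j) Nij => // H _.
  by rewrite share_tri // [i == j.+1](_ : _ = false) ?orbF //; lia.
by rewrite share_edgeC share_tri // [j == i.+1](_ : _ = false) //; lia.
Qed.

(** For a linear tree the last triangle is the end of the dual path away from the root; on [Leaf]
    the default [set0] is incident to nothing. *)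
Definition tip a t b (A : {set V}) := incident A (last set0 (tri_sets a t b)).

Lemma connects_poly a t b A : uniq (cyc a t b) -> t <> Leaf -> linear t ->
  tip a t b A -> connects (polygon a t b) [set a; b] A.
Proof.
move=> U Ht L HA; have [o [So Hi Ut]] := standard_poly U Ht.
split; first by have [] := maxouter_poly U Ht.
exists (rotation U), o, (tri_sets a t b); split=> //.
- exact: dual_path_tri.
- case: t Ht {HA L So Hi Ut} U => // t1 c t2 _ U.
  by rewrite nth0 incident_root eqxx orbT.
- by rewrite nth_last.
Qed.

Lemma outerplanar_path_poly a t b : uniq (cyc a t b) -> t <> Leaf -> linear t ->
  outerplanar_path (polygon a t b).
Proof.
move=> U Ht L; have [o [So Hi Ut]] := standard_poly U Ht.
split; first by have [] := maxouter_poly U Ht.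
by exists (rotation U), o, (tri_sets a t b); split=> //; apply: dual_path_tri.
Qed.

(** Any outer edge can serve as root edge: the cycle is rotated until [x] is its last vertex, and
    the successor [y] comes first. *)
Lemma arcs_root a t b x y : uniq (cyc a t b) -> t <> Leaf ->
  (x, y) \in arcs (cyc a t b) -> exists t', [/\ uniq (cyc y t' x), t' <> Leaf,
    perm_eq (cyc y t' x) (cyc a t b) & polygon a t b = polygon y t' x].
Proof.
move=> U Ht; rewrite arcsE // => /mapP[x' Hx [Ex' Ey]]; subst x'.
have [n r Er] := rot_to Hx.
have [a' [t1 [b' [E1 E2]]]] := polygon_rot n a b Ht.
have sz u v (s : tree V) : size (cyc u s v) = (size (inner s)).+2.
  by rewrite /= size_cat addn1.
have nl u v (s : tree V) : size (cyc u s v) = size (cyc a t b) -> s <> Leaf.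
  rewrite !sz => -[Es] Hs; move: Es; rewrite Hs.
  by case: (t) Ht => //= u1 c u2 _; rewrite size_cat addnS.
have [|y' [t' [E3 E4]]] := @polygon_rot1 V a' t1 b'.
  by apply: (nl a' b'); rewrite E1 size_rot.
have E5 : cyc y' t' a' = rcons r x by rewrite E3 E1 Er rot1_cons.
have [Ex Eyy] : a' = x /\ y' = y.
  split.
    have := congr1 (last y) E5; rewrite last_rcons => <-.
    by rewrite /cyc /= last_cat.
  have -> : y = next (cyc a t b) x by [].
  rewrite -(next_rot n) // Er; case: r Er E5 => [|z r'] Er /= [-> _].
    by have := congr1 size Er; rewrite size_rot sz.
  by rewrite eqxx.
subst a' y'; exists t'.
have P : perm_eq (cyc y t' x) (cyc a t b).
  by rewrite E3 E1; apply/permPl => z; rewrite !perm_rot.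
have U' : uniq (cyc y t' x) by rewrite (perm_uniq P).
split=> //; first by apply: (nl y x); exact: perm_size.
apply: poly_eq => // z; first by rewrite (perm_mem P).
by rewrite E4 E2.
Qed.

(** Without [a] and [b] the outer cycle is still a path through all remaining vertices. *)
Lemma root_non_cutting a t b : uniq (cyc a t b) ->
  non_cutting_edge (polygon a t b) [set a; b].
Proof.
move=> U; have HE : [set a; b] \in edge (polygon a t b).
  by apply/edge_polyP => //; exists a, b; rewrite drt_head.
rewrite /non_cutting_edge /cutting_edge HE /= negbK.
have -> : vert (polygon a t b) :\: [set a; b] = [set x in inner t].
  apply/setP=> x; rewrite vert_poly !inE mem_cat mem_seq1 negb_or.
  move: U; rewrite /cyc /= mem_cat mem_seq1 negb_or cats1 rcons_uniq.
  case/andP=> /andP[Na _] /andP[Nb _].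
  have [->|] := eqVneq x a; first by rewrite (negPf Na).
  by have [->|] := eqVneq x b; rewrite ?(negPf Nb) ?orbF.
apply: connected_path; have := sorted_cyc U.
rewrite /cyc /= cats1 rcons_path => /andP[] /path_sorted //.
Qed.

Lemma arcs_non_cutting a t b x y : uniq (cyc a t b) -> t <> Leaf ->
  (x, y) \in arcs (cyc a t b) -> non_cutting_edge (polygon a t b) [set x; y].
Proof.
move=> U Ht /(arcs_root U Ht)[t' [U' _ _ ->]].
by rewrite setUC; apply: root_non_cutting.
Qed.

Lemma sides_non_cutting a t b x y : uniq (cyc a t b) -> t <> Leaf ->
  (x, y) \in sides a t b -> non_cutting_edge (polygon a t b) [set x; y].
Proof.
move=> U Ht H; apply: arcs_non_cutting => //.
by rewrite arcs_cyc mem_rcons inE H orbT.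
Qed.

(** Once [x] and [y] are removed, [inner s] is closed under adjacency ([sub_inner_drt]), and both
    sides of the chord have a vertex left. *)
Lemma chord_cutting a t b x s y : uniq (cyc a t b) -> sub a t b x s y ->
  s <> Leaf -> (x, y) <> (a, b) -> cutting_edge (polygon a t b) [set x; y].
Proof.
move=> U Hs Ns Nxy; apply/andP; split.
  apply/edge_polyP => //; exists x, y; split=> //.
  by apply: (sub_drt Hs); apply: drt_head.
have [r [Pr Er]] := sub_root U Hs.
have Ur : uniq (x :: inner s ++ y :: inner r) by rewrite -(perm_uniq Pr).
have [p Hp] : exists p, p \in inner s.
  by case: (s) Ns => // s1 p s2 _; exists p; rewrite mem_cat mem_head orbT.
(* With nothing on the far side, a comparison of lengths makes [xy] the root edge. *)
have [q Hq] : exists q, q \in inner r.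
  case Ei: (inner r) => [|q l]; last by exists q; rewrite mem_head.
  case: Nxy; have [s0 [s1 Es]] := sub_cyc Hs.
  have := perm_size Pr; rewrite Es Ei !size_cat /= size_cat /= => Hsz.
  have [/size0nil E0 /size0nil E1] : size s0 = 0 /\ size s1 = 0 by lia.
  move: Es; rewrite E0 E1 cats0 => -[-> E]; congr pair.
  by have := congr1 (last a) E; rewrite !last_cat.
have memP z : z \in vert (polygon a t b) = (z \in x :: inner s ++ y :: inner r).
  by rewrite vert_poly in_set (perm_mem Pr).
have dis z : z \in inner s -> z \in inner r -> False.
  move=> H1 H2; move: Ur; rewrite -cat_cons cat_uniq => /and3P[_ /hasPn/(_ z)].
  by rewrite inE H2 orbT inE H1 orbT => /(_ isT).
apply/negP=> /forall_inP/(_ p) H.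
have out z : z \in inner s ++ inner r -> z \in vert (polygon a t b) :\: [set x; y].
  move=> Hz; rewrite in_setD memP !inE mem_cat inE negb_or.
  move: Ur; rewrite /= mem_cat inE !negb_or cat_uniq => /and3P[/and3P[N1 _ N3] U1 /and3P[H2 N4 U2]].
  have -> : z != x by apply: contraTneq Hz => ->; rewrite mem_cat negb_or N1.
  have -> : z != y.
    apply: contraTneq Hz => ->; rewrite mem_cat negb_or N4 andbT.
    by move: H2; rewrite /= negb_or => /andP[].
  by move: Hz; rewrite mem_cat => /orP[]->; rewrite ?orbT.
set W := vert _ :\: _ in H out.
have {}H := H (out p _).
have {H} /forall_inP/(_ q) : [forall y0 in W, connect [rel a0 b0 | [&& a0 \in W, b0 \in W & adj (polygon a t b) a0 b0]] p y0].
  by apply: H; rewrite mem_cat Hp.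
have Hq' : q \in W by apply: out; rewrite mem_cat Hq orbT.
move=> /(_ Hq'); set e := [rel _ _ | _] => Hc.
have step u v : e u v -> u \in inner s -> v \in inner s.
  case/and3P=> Hu Hv; rewrite adj_poly // => Huv Hus.
  have [_] := drt_cyc (sub_inner_drt U Hs Hus Huv).
  move: Hv; rewrite in_setD in_set2 negb_or => /andP[/andP[/negPf Nx /negPf Ny] _].
  by rewrite inE mem_cat mem_seq1 Nx Ny orbF.
have cl : closed e (mem (inner s)).
  move=> u v Huv; apply/idP/idP; apply: step => //.
  by move: Huv => /and3P[Hu Hv Ha]; rewrite /e /= Hu Hv /adj /= setUC.
by apply: (dis q) => //; have := closed_connect cl Hc; rewrite Hp => /esym.
Qed.

End Linear.

(** * From a standard embedding to a tree *)

Section Ears.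

Variable V : finType.
Implicit Types (t : tree V) (a b c x y z : V).

Definition tri_darts (T : V * V * V) : seq (V * V) :=
  let: (x, y, z) := T in [:: (x, y); (y, z); (z, x)].

Lemma arcs_rot n (s : seq V) : uniq s -> perm_eq (arcs (rot n s)) (arcs s).
Proof.
move=> U; rewrite !arcsE ?rot_uniq // (eq_map (g := fun x => (x, next s x))).
  by apply: perm_map; rewrite perm_rot.
by move=> x; rewrite next_rot.
Qed.

Lemma rot_inv n (s : seq V) : exists m, rot m (rot n s) = s.
Proof. by exists (size (rot n s) - n); apply: rotK. Qed.

Lemma pigeonhole_flatten (T U : eqType) (h : U -> seq T) (M : seq T) (Ts : seq U) :
  uniq M -> {subset M <= flatten (map h Ts)} -> size Ts < size M ->
  exists2 t, t \in Ts & 1 < count (mem M) (h t).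
Proof.
move=> UM sM lt; apply/hasP; apply: contraTT lt => /hasPn H; rewrite -leqNgt.
have : size M <= count (mem M) (flatten (map h Ts)).
  rewrite -size_filter; apply: uniq_leq_size => // d Hd.
  by rewrite mem_filter sM // andbT.
move/leq_trans; apply; elim: Ts H {sM} => //= u Ts IH H.
rewrite count_cat -add1n leq_add //; last by apply: IH => v Hv; apply: H; rewrite inE Hv orbT.
by have := H u (mem_head _ _); rewrite -leqNgt.
Qed.

(* Two of the three sides of some triangle lie on the outer cycle, because
   there are fewer triangles than outer edges. *)
Lemma ear_exists s (Ts : seq (V * V * V)) : uniq s -> size s = (size Ts).+2 ->
  0 < size Ts ->
  {subset map (@rev_dart V) (arcs s) <= flatten (map tri_darts Ts)} ->
  exists m x y z s' T, [/\ rot m s = x :: y :: z :: s', T \in Ts &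
    perm_eq (tri_darts T) [:: (z, y); (y, x); (x, z)]].
Proof.
move=> U Es Ts0 sub.
have UM : uniq (map (@rev_dart V) (arcs s)).
  rewrite map_inj_uniq; last by move=> [x y] [u v] [-> ->].
  by rewrite arcsE // map_inj_uniq // => x y [].
have [|[[x0 y0] z0] HT Hc] := pigeonhole_flatten UM sub.
  by rewrite size_map size_zip size_rot minnn Es.
(* The triangle is rotated so that its two outer sides come first; [r], [q], [p] are then
   consecutive on the cycle. *)
have [p [q [r [Hpq Hqr HP]]]] : exists p q r,
    [/\ (q, p) \in arcs s, (r, q) \in arcs s &
        perm_eq (tri_darts (x0, y0, z0)) [:: (p, q); (q, r); (r, p)]].
  have memM u v : (u, v) \in map (@rev_dart V) (arcs s) -> (v, u) \in arcs s.
    by case/mapP=> -[u' v'] H [-> ->].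
  move: Hc => /=; case H1: (_ \in _); case H2: (_ \in _); case H3: (_ \in _) => // _.
  - by exists x0, y0, z0; split; rewrite ?memM.
  - by exists x0, y0, z0; split; rewrite ?memM.
  - exists z0, x0, y0; split; rewrite ?memM //.
    by rewrite (perm_catC [:: (x0, y0); (y0, z0)] [:: (z0, x0)]).
  - exists y0, z0, x0; split; rewrite ?memM //.
    by rewrite (perm_catC [:: (x0, y0)] [:: (y0, z0); (z0, x0)]).
have Nx u v : (u, v) \in arcs s -> u \in s /\ next s u = v.
  by rewrite arcsE // => /mapP[w Hw [-> ->]].
have [Hr Er] := Nx _ _ Hqr; have [Hq Eq] := Nx _ _ Hpq.
have [m s1 Em] := rot_to Hr.
have Um : uniq (r :: s1) by rewrite -Em rot_uniq.
have sz := congr1 size Em; rewrite size_rot Es in sz.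
case: s1 Em Um sz => [|q' [|p' s']] Em Um /= sz; try by [case: sz Ts0 => ->].
- by [].
have N u : next s u = next [:: r, q', p' & s'] u by rewrite -Em next_rot.
have Eq' : q' = q by rewrite -Er N /= eqxx.
subst q'; have Ep' : p' = p by rewrite -Eq N (@next_mid _ [:: r]).
by subst p'; exists m, r, q, p, s', (x0, y0, z0).
Qed.

(* Vertex links play no role: the number of triangles alone keeps producing ears
   until the outer cycle is a single edge. *)
Lemma disk_tree s (Ts : seq (V * V * V)) (L := arcs s ++ flatten (map tri_darts Ts)) :
  uniq s -> size s = (size Ts).+2 -> uniq L ->
  (forall d, d \in L -> rev_dart d \in L) ->
  exists a t b, cyc a t b = s /\ drt a t b =i L.
Proof.
have [k Ek] := ubnP (size Ts).
elim: k s Ts @L Ek => // k IH s Ts L Ek U Es UL RL.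
case: Ts => [|T0 Ts0] in L Ek Es UL RL *.
  case: s U Es @L UL RL => [|x [|y []]] // U _ L _ _.
  exists x, Leaf, y; split=> //.
(* On a cycle with more than two vertices the reverse of an arc is not an arc, so it must belong to
   a triangle. *)
have Hsub : {subset map (@rev_dart V) (arcs s) <= flatten (map tri_darts (T0 :: Ts0))}.
  move=> _ /mapP[[x y] Hxy ->].
  have := RL (x, y); rewrite {1}/L mem_cat Hxy => /(_ isT).
  rewrite /L mem_cat => /orP[|//].
  move: Hxy; rewrite !arcsE // => /mapP[x1 Hx [Ex Ey]] /mapP[z Hz [/= Ez Ez']].
  exfalso; subst x1 z; have [m s' Em] := rot_to Hx.
  have sz := congr1 size Em; rewrite size_rot Es /= in sz.
  case: s' Em sz => [|y' [|z' s']] Em /= sz; try lia.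
  have Um : uniq [:: x, y', z' & s'] by rewrite -Em rot_uniq.
  have N u : next s u = next [:: x, y', z' & s'] u by rewrite -Em next_rot.
  have E1 : y = y' by rewrite Ey N /= eqxx.
  have E2 : x = z' by rewrite Ez' E1 N (@next_mid _ [:: x]).
  by move: Um; rewrite /= E2 !inE eqxx orbT.
have [//|m [x [y [z [s' [T [Em HT HP]]]]]]] := ear_exists U Es _ Hsub.
set Ts := T0 :: Ts0 in L Ek Es UL RL Hsub HT *.
pose Ts' := rem T Ts.
have PT : perm_eq Ts (T :: Ts') by apply: perm_to_rem.
pose s2 := z :: rcons s' x.
have Um : uniq [:: x, y, z & s'] by rewrite -Em rot_uniq.
have U' : uniq (x :: z :: s').
  by move: Um; rewrite /= !inE !negb_or => /and3P[/andP[_ ->] /andP[_ _] ->].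
have Es2 : s2 = rot 1 (x :: z :: s') by rewrite rot1_cons.
have U2 : uniq s2 by rewrite Es2 rot_uniq.
pose L' := arcs s2 ++ flatten (map tri_darts Ts').
(* Cutting off the ear [xyz] turns its third side [(x, z)] into an arc of the shorter cycle; only
   the darts at [y] disappear. *)
have PL : perm_eq L ([:: (x, y); (y, z); (z, y); (y, x)] ++ L').
  rewrite /L /L'.
  have P1 : perm_eq (arcs s) (arcs [:: x, y, z & s']) by rewrite -Em perm_sym arcs_rot.
  have P2 : perm_eq (arcs s2) (arcs (x :: z :: s')).
    by rewrite Es2 arcs_rot.
  have P3 : perm_eq (flatten (map tri_darts Ts)) (tri_darts T ++ flatten (map tri_darts Ts')).
    have := perm_flatten (perm_map tri_darts PT); exact.
  move: P1 P2 P3 HP => /seq.permP P1 /seq.permP P2 /seq.permP P3 /seq.permP P4.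
  apply/seq.permP=> P; have {}P1 := P1 P; have {}P2 := P2 P; have {}P3 := P3 P; have {}P4 := P4 P.
  rewrite count_cat P1 P3 !count_cat P2 P4 /arcs !rot1_cons /=.
  by do !move: (nat_of_bool _); do !move: (count P _); clear; lia.
have UL' : uniq ([:: (x, y); (y, z); (z, y); (y, x)] ++ L') by rewrite -(perm_uniq PL).
have sTs : size Ts = (size Ts').+1 := perm_size PT.
have [|||||a [t [b [Ec Ed]]]] := IH s2 Ts'.
- by rewrite sTs in Ek.
- exact: U2.
- by have := congr1 size Em; rewrite size_rot Es sTs /s2 /= size_rcons => -[->].
- by move: UL'; rewrite cat_uniq => /and3P[].
(* The four discarded darts are closed under reversal, hence so is the rest. *)
- move=> d Hd; have Hd2 : d \in L by rewrite (perm_mem PL) mem_cat -/L' Hd orbT.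
  have := RL d Hd2; rewrite (perm_mem PL) mem_cat => /orP[|//] Hr.
  exfalso; move: UL'; rewrite cat_uniq => /and3P[_ /hasPn/(_ d Hd) + _].
  case: d Hr {Hd Hd2} => u v; rewrite /rev_dart /= !inE !xpair_eqE.
  by case/or4P=> /andP[/eqP-> /eqP->]; rewrite !eqxx ?orbT.
have [Ea Eb] : a = z /\ b = x.
  move: Ec; rewrite /s2 /cyc cats1 => -[-> /rcons_inj[_ ->]] //.
subst a b.
have [n En] := rot_inv 1 [:: x, y, z & s'].
have [m' Em'] := rot_inv m s.
(* The ear comes back as the new root triangle; two rotations then restore the order of [s]. *)
pose t1 := Node Leaf z t.
have Ht1 : t1 <> Leaf by [].
have E1 : cyc y t1 x = rot 1 (rot m s).
  by rewrite Em rot1_cons /t1 cyc_node Ec.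
have [a [t2 [b [E2 D2]]]] := polygon_rot n y x Ht1.
have Ht2 : t2 <> Leaf.
  by move=> E; have := congr1 size E2; rewrite E size_rot E1 Em size_rot.
have [a' [t3 [b' [E3 D3]]]] := polygon_rot m' a b Ht2.
exists a', t3, b'; split; first by rewrite E3 E2 E1 Em En -Em Em'.
move=> d; rewrite D3 D2 (perm_mem PL) [RHS]mem_cat -(Ed d : _ = (d \in L')).
rewrite /t1; apply/idP/orP.
  case/in_drt_node=> [->|->|H|H].
  - by left; rewrite !inE eqxx !orbT.
  - by left; rewrite !inE eqxx.
  - left; move: H; case: (d) => u v; rewrite drtP !inE !xpair_eqE /=.
    by case/orP=> /andP[/eqP-> /eqP->]; rewrite !eqxx ?orbT.
  - by right.
case=> H; apply/in_drt_node; last by apply: Or44.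
rewrite !inE in H; case/or4P: H => /eqP->.
- by apply: Or42.
- by apply: Or43; apply: drt_head.
- by apply: Or43; rewrite drt_sym drt_head.
- by apply: Or41.
Qed.

Lemma uniq_flatten_map (T U : eqType) (h : U -> seq T) (F : seq U) :
  uniq F -> {in F, forall f, uniq (h f)} ->
  {in F &, forall f g d, d \in h f -> d \in h g -> f = g} -> uniq (flatten (map h F)).
Proof.
elim: F => //= f F IH /andP[Nf UF] Hu Hd; rewrite cat_uniq Hu ?mem_head //=.
rewrite IH ?andbT //; last first.
- by move=> g1 g2 H1 H2; apply: Hd; rewrite inE ?H1 ?H2 orbT.
- by move=> g Hg; apply: Hu; rewrite inE Hg orbT.
apply/hasPn=> d /flattenP[_ /mapP[g Hg ->] Hdg]; apply/negP=> Hdf.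
by move: Nf; rewrite (Hd f g _ _ d) ?Hg ?mem_head ?inE ?Hg ?orbT.
Qed.

Lemma fcycle_map (T : eqType) (f : T -> T) p : fcycle f p -> map f p = rot 1 p.
Proof.
case: p => //= x q; rewrite rot1_cons => H.
have : forall y : T, fpath f y (rcons q x) -> map f (y :: q) = rcons q x.
  elim: (q) => [|z r IH] y /= /andP[/eqP-> Hr] //.
  by congr cons; apply: IH.
exact.
Qed.

Lemma edge_props (G : sgraph V) A : A \in edge G -> #|A| = 2 /\ A \subset vert G.
Proof. by case: G => v e /= /forall_inP H /H/andP[/eqP]. Qed.

Lemma edge_pair (G : sgraph V) A : A \in edge G -> exists x y,
  [/\ x != y, A = [set x; y], adj G x y & adj G y x].
Proof.
move=> HA; have [cA _] := edge_props HA; have /cards2P[x [y [Nxy E]]] : #|A| == 2 by rewrite cA.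
exists x, y; split; rewrite // /adj /= ?(setUC [set y]) -E //.
Qed.

Lemma card_darts (G : sgraph V) : #|darts G| = 2 * #|edge G|.
Proof.
rewrite -sum1_card (partition_big (@pset V) (mem (edge G))) /=; last first.
  by move=> d; rewrite inE.
rewrite mulnC -sum_nat_const; apply: eq_bigr => A HA.
have [x [y [Nxy E Hxy Hyx]]] := edge_pair HA.
rewrite sum1dep_card -[RHS](_ : #|[set (x, y); (y, x)]| = 2); last first.
  by rewrite cards2 xpair_eqE (negPf Nxy).
apply: eq_card => -[u v]; rewrite !inE !xpair_eqE E.
apply/andP/orP => [[_ /eqP/set2_eq[[/= -> ->]|[/= -> ->]]]|]; rewrite ?eqxx; auto.
by case=> /andP[/eqP-> /eqP->]; split=> //; rewrite /pset //= setUC.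
Qed.

(** * The outer cycle and the triangles of a given embedding *)

Section FromEmbedding.

Variables (G : sgraph V) (rho : {perm V * V}) (o : {set V * V}).
Hypothesis So : standard_embedding G rho o.
Let phi := face_next rho.

Lemma phi_dart d : d \in darts G -> phi d \in darts G /\ (phi d).1 = d.2.
Proof.
case: So => -[Hr _ _] _ _ _ _ Hd.
have Hd' : rev_dart d \in darts G by move: Hd; rewrite !inE /adj /= setUC.
have := mem_porbit rho 1 (rev_dart d); rewrite (Hr _ Hd') inE expg1.
by case/andP=> H /eqP.
Qed.

Lemma phi_inj : injective phi.
Proof. by move=> [x y] [u v] /perm_inj[-> ->]. Qed.

Lemma face_orbit d : face_of rho d =i fingraph.orbit phi d.
Proof. by move=> d'; rewrite inE fconnect_orbit. Qed.

Lemma orbit_darts d : d \in darts G -> {subset fingraph.orbit phi d <= darts G}.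
Proof.
move=> Hd d'; rewrite -fconnect_orbit => /iter_findex <-.
by elim: (findex _ _ _) => //= n /phi_dart[].
Qed.

Lemma faces_disjoint f g d : f \in faces G rho -> g \in faces G rho ->
  d \in f -> d \in g -> f = g.
Proof.
move=> /imsetP[d1 _ ->] /imsetP[d2 _ ->]; rewrite !inE => H1 H2.
have cs := fconnect_sym phi_inj.
apply/setP=> x; rewrite !inE; apply: (same_connect cs).
by apply: connect_trans H1 _; rewrite cs.
Qed.

Lemma face_triple f : f \in faces G rho -> #|f| = 3 -> exists T, f =i tri_darts T.
Proof.
case/imsetP=> d Hd ->; rewrite /face_of cardsE -/phi -[#|_|]/(fingraph.order phi d) => Ho.
have [Hd1 E1] := phi_dart Hd; have [Hd2 E2] := phi_dart Hd1.
have [_ E3] := phi_dart Hd2.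
have := iter_order phi_inj d; rewrite Ho /= => E.
exists (d.1, d.2, (phi d).2) => x; rewrite face_orbit /fingraph.orbit Ho /=.
move: E1 E2 E3; rewrite E; case: (phi (phi d)) => u2 v2; case: (phi d) => u1 v1.
by case: (d) => u v /= -> -> ->.
Qed.

Lemma standard_tree : 3 <= #|vert G| -> exists a t b,
  [/\ uniq (cyc a t b), t <> Leaf & G = polygon a t b].
Proof.
move=> n3; case: (So) => -[_ _ Euler] Ho Hinj Hv Htri.
have [d0 Hd0 Eo] := imsetP Ho.
pose ol := fingraph.orbit phi d0.
have Eol : o =i ol by rewrite Eo; apply: face_orbit.
have Uol : uniq ol := orbit_uniq phi d0.
have Col : fcycle phi ol := cycle_orbit phi_inj d0.
pose s := map fst ol.
have Us : uniq s by rewrite map_inj_in_uniq // => d d' H1 H2; apply: Hinj; rewrite Eol.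
have Es : arcs s = ol.
  rewrite /arcs; have -> : rot 1 s = map snd ol.
    rewrite -map_rot -(fcycle_map Col) -map_comp; apply/eq_in_map => d Hd /=.
    by have [] := phi_dart (orbit_darts Hd0 Hd).
  exact: zip_unzip.
have Hs x : (x \in s) = (x \in vert G).
  rewrite -Hv; apply/mapP/imsetP => [[d Hd ->]|[d Hd ->]]; exists d => //.
    by rewrite Eol.
  by rewrite -Eol.
(* An interior face is a triangle, so [pick] succeeds on it; elsewhere the value is arbitrary. *)
pose g f : V * V * V := odflt (d0.1, d0.1, d0.1) [pick T | f == [set d in tri_darts T]].
have Hg f : f \in faces G rho :\ o -> f =i tri_darts (g f).
  move=> Hf; rewrite /g; case: pickP => [T /eqP {1}-> d|H]; first by rewrite inE.
  have [T HT] := face_triple (proj2 (andP (etrans (esym (in_setD1 _ _ _)) Hf))) (Htri f Hf).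
  by have /eqP[] := H T; apply/setP=> d; rewrite inE HT.
pose Fl := enum (faces G rho :\ o).
pose Ts := map g Fl.
pose L := arcs s ++ flatten (map tri_darts Ts).
pose h f := if f == o then ol else tri_darts (g f).
have Hh f : f \in faces G rho -> f =i h f.
  rewrite /h; have [->//|Nf] := eqVneq f o => Hf.
  by apply: Hg; rewrite in_setD1 Nf.
have EL : L = flatten (map h (o :: Fl)).
  rewrite /= {1}/h eqxx /L Es /Ts -map_comp; congr (_ ++ flatten _).
  apply/eq_in_map => f; rewrite mem_enum in_setD1 /h /= => /andP[/negPf-> //].
have HFl f : f \in o :: Fl -> f \in faces G rho.
  by rewrite inE mem_enum in_setD1 => /predU1P[->|/andP[]].
have card3 f : f \in Fl -> #|f| = 3 by rewrite mem_enum => /Htri.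
have UL : uniq L.
  rewrite EL; apply: uniq_flatten_map.
  - by rewrite /= enum_uniq mem_enum in_setD1 eqxx.
  - move=> f; rewrite inE => /predU1P[->|Hf]; first by rewrite /h eqxx.
    apply/card_uniqP; rewrite -(eq_card (Hh f _)) ?HFl ?inE ?Hf ?orbT // card3 //.
    rewrite /h; case: eqP => [Ef|_]; last by case: (g f) => -[].
    by move: Hf; rewrite Ef mem_enum in_setD1 eqxx.
  - move=> f f' Hf Hf' d; rewrite -!Hh ?HFl //; apply: faces_disjoint; exact: HFl.
have ELd : L =i darts G.
  move=> d; rewrite EL; apply/flattenP/idP.
    move=> [_ /mapP[f Hf ->]]; rewrite -Hh ?HFl //.
    have /imsetP[d1 Hd1 ->] := HFl f Hf; rewrite face_orbit; exact: orbit_darts.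
  move=> Hd; have Hf : face_of rho d \in faces G rho by apply: imset_f.
  exists (h (face_of rho d)); last by rewrite -Hh // inE connect0.
  by apply: map_f; rewrite inE mem_enum in_setD1 Hf andbT; case: eqP.
have szT : size Ts = #|faces G rho|.-1.
  by rewrite size_map -cardE (cardsD1 o (faces G rho)) Ho.
have szs : size s = #|vert G|.
  by rewrite -(eq_card Hs); apply/esym/card_uniqP.
have szL : size L = size s + 3 * size Ts.
  rewrite size_cat size_zip size_rot minnn; congr addn.
  by elim: (Ts) => // -[[x y] z] Ts' /= ->; lia.
have F0 : 0 < #|faces G rho| by apply/card_gt0P; exists o.
(* With n outer vertices and k triangles, counting darts gives 2|E| = n + 3k, and Euler's formula n
   + (k + 1) = |E| + 2; together n = k + 2. *)
have sz : size s = (size Ts).+2.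
  have := card_darts G; rewrite -(eq_card ELd); have /card_uniqP -> := UL.
  by rewrite szL; move: Euler; rewrite -szs; lia.
have [|a [t [b [Ec Ed]]]] := disk_tree Us sz UL.
  by move=> d; rewrite !ELd !inE /adj /= setUC.
have Uc : uniq (cyc a t b) by rewrite Ec.
exists a, t, b; split=> //.
  by move=> Et; move: n3; rewrite -szs -Ec Et.
apply: sgraph_eq; first by apply/setP=> x; rewrite vert_poly in_set Ec Hs.
have AD x y : adj G x y = ((x, y) \in drt a t b) by rewrite Ed ELd inE.
apply/setP=> A; apply/idP/(edge_polyP _ Uc) => [HA|[x [y [-> H]]]].
  by have [x [y [_ E Hxy _]]] := edge_pair HA; exists x, y; rewrite -AD.
by have := AD x y; rewrite H.
Qed.

End FromEmbedding.

Lemma maxouter_tree (G : sgraph V) : maximal_outerplanar G -> exists a t b,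
  [/\ uniq (cyc a t b), t <> Leaf & G = polygon a t b].
Proof. by case=> n3 [rho [o So]]; apply: standard_tree So n3. Qed.

End Ears.

(** * Umbrellas *)

Section Prune.

Variable V : finType.
Implicit Types (t u h : tree V) (a b c x y z : V).

(** [u] arises from [t] by cutting subtrees back to leaves; umbrellas are such trees, and the
    hanging pieces are among the subtrees cut off. *)
Fixpoint prune u t : bool :=
  match u, t with
  | Leaf, _ => true
  | Node u1 c u2, Node t1 d t2 => [&& c == d, prune u1 t1 & prune u2 t2]
  | _, _ => false
  end.

(** Reflection exchanges the two roots, so the fan at the right root needs no construction of its
    own. *)
Fixpoint mir t := if t is Node t1 c t2 then Node (mir t2) c (mir t1) else Leaf.

(** The triangles with a corner at the left root, that is, its full fan. *)
Fixpoint lspine t := if t is Node t1 c t2 then Node (lspine t1) c Leaf else Leaf.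

Lemma sub_inner a t b x s y : sub a t b x s y -> {subset inner s <= inner t}.
Proof.
elim=> {a t b x s y} [a t b z //|a t1 c t2 b x s y _ IH z /IH Hz|
  a t1 c t2 b x s y _ IH z /IH Hz]; by rewrite mem_cat ?inE Hz ?orbT.
Qed.

Lemma mirK : involutive mir.
Proof. by elim=> //= t1 -> c t2 ->. Qed.

Lemma inner_mir t : inner (mir t) = rev (inner t).
Proof. by elim: t => //= t1 IH1 c t2 IH2; rewrite IH1 IH2 rev_cat rev_cons cat_rcons. Qed.

Lemma cyc_mir a t b : cyc b (mir t) a = rev (cyc a t b).
Proof. by rewrite /cyc inner_mir rev_cons rev_cat /= cats1. Qed.

Lemma uniq_mir a t b : uniq (cyc b (mir t) a) = uniq (cyc a t b).
Proof. by rewrite cyc_mir rev_uniq. Qed.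

Lemma mem_mir a t b : cyc b (mir t) a =i cyc a t b.
Proof. by move=> x; rewrite cyc_mir mem_rev. Qed.

Lemma drt_mir a t b : drt b (mir t) a =i drt a t b.
Proof.
move=> p; elim: t a b => [|t1 IH1 c t2 IH2] a b.
  by case: p => x y; rewrite !drtP !inE !xpair_eqE orbC (andbC (y == b)) (andbC (x == b)).
by apply/idP/idP => /in_drt_node[H|H|H|H]; apply/in_drt_node;
 [apply: Or42|apply: Or41|apply: Or44; rewrite -IH2|apply: Or43; rewrite -IH1|
  apply: Or42|apply: Or41|apply: Or44; rewrite IH1|apply: Or43; rewrite IH2].
Qed.

Lemma prune_mir u t : prune (mir u) (mir t) = prune u t.
Proof.
elim: u t => [|u1 IH1 c u2 IH2] [|t1 d t2] //=.
by rewrite IH1 IH2 [prune u2 _ && _]andbC.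
Qed.

Lemma prune_refl t : prune t t.
Proof. by elim: t => //= t1 -> c t2 ->; rewrite eqxx. Qed.

Lemma prune_subseq u t : prune u t -> subseq (inner u) (inner t).
Proof.
elim: u t => [|u1 IH1 c u2 IH2] [|t1 d t2] //= => [_|]; first exact: sub0seq.
case/and3P=> /eqP-> /IH1 H1 /IH2 H2; apply: cat_subseq => //=.
by rewrite eqxx.
Qed.

Lemma prune_cyc u t a b : prune u t -> subseq (cyc a u b) (cyc a t b).
Proof. by move=> H; rewrite /cyc /= eqxx; apply: cat_subseq => //; apply: prune_subseq. Qed.

Lemma prune_uniq u t a b : prune u t -> uniq (cyc a t b) -> uniq (cyc a u b).
Proof. by move=> H; apply: subseq_uniq; apply: prune_cyc. Qed.

Lemma prune_drt u t a b : prune u t -> {subset drt a u b <= drt a t b}.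
Proof.
elim: u t a b => [|u1 IH1 c u2 IH2] t a b H p.
  case: p => x y; rewrite drtP !inE !xpair_eqE.
  by case/orP=> /andP[/eqP-> /eqP->]; rewrite 1?drt_sym ?drt_head // drt_sym drt_head.
case: t H => //= t1 _ t2 /and3P[/eqP <- H1 H2].
case/in_drt_node=> H; apply/in_drt_node; [apply: Or41|apply: Or42|apply: Or43|apply: Or44] => //;
[exact: (IH1 t1)|exact: (IH2 t2)].
Qed.

(** Identifies the piece cut off at a side of [u]: it meets [u] in the ends of that side only. *)
Lemma prune_side u t a b x y : uniq (cyc a t b) -> prune u t ->
  sub a u b x Leaf y -> exists2 s, sub a t b x s y & {in inner s, forall z, z \notin cyc a u b}.
Proof.
move E: Leaf => l U H Hs; elim: Hs t U H E => {a u b x l y}.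
- move=> a l b t U _ <-; exists t; first by constructor.
  move=> z Hz; move: U; rewrite /cyc /= mem_cat negb_or cats1 rcons_uniq.
  case/andP=> /andP[Na _] /andP[Nb _].
  by rewrite !inE negb_or; apply/andP; split; apply: contraTneq Hz => ->.
- move=> a u1 c u2 b x l y _ IH [//|t1 d t2] U /= /and3P[/eqP Ed H1 H2] E; subst d.
  have [s Hs Hd] := IH t1 (uniq_cyc_l U) H1 E.
  exists s; first exact: sub_l.
  move=> z Hz; rewrite cyc_node_l mem_cat negb_or Hd //=.
  have [s0 [s1 Es]] := sub_cyc Hs.
  have Hz1 : z \in cyc a t1 c by rewrite Es !(mem_cat, inE) Hz !orbT.
  have : z \notin inner t2 ++ [:: b].
    apply: contraTN U => Hz2; rewrite cyc_node_l cat_uniq; apply/nandP; right.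
    by apply/nandP; left; rewrite negbK; apply/hasP; exists z.
  apply: contra; rewrite !mem_cat => /orP[|->]; rewrite ?orbT //.
  by move/(mem_subseq (prune_subseq H2)) => ->.
- move=> a u1 c u2 b x l y _ IH [//|t1 d t2] U /= /and3P[/eqP Ed H1 H2] E; subst d.
  have [s Hs Hd] := IH t2 (uniq_cyc_r U) H2 E.
  exists s; first exact: sub_r.
  move=> z Hz; rewrite cyc_node -cat_cons mem_cat negb_or Hd // andbT.
  have [s0 [s1 Es]] := sub_cyc Hs.
  have Hz1 : z \in cyc c t2 b by rewrite Es !(mem_cat, inE) Hz !orbT.
  have : z \notin a :: inner t1.
    apply: contraTN U => Hz2; rewrite cyc_node -cat_cons cat_uniq; apply/nandP; right.
    by apply/nandP; left; rewrite negbK; apply/hasP; exists z.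
  apply: contra; rewrite !inE => /orP[->//|].
  by move/(mem_subseq (prune_subseq H1)) => ->; rewrite orbT.
Qed.

Lemma linear_lspine t : linear (lspine t).
Proof. by elim: t => //= t1 -> _ _ _; rewrite orbT. Qed.

Lemma prune_lspine t : prune (lspine t) t.
Proof. by elim: t => //= t1 -> c _ _; rewrite eqxx. Qed.

Lemma root_nbr_l a t b z : uniq (cyc a t b) -> (a, z) \in drt a t b ->
  z \in cyc a (lspine t) b.
Proof.
elim: t b => [|t1 IH c t2 _] b U.
  by move/drt_cyc=> [].
case/in_drt_node=> [[->]|[E ->]|H|/drt_cyc[H _]].
- by rewrite /cyc !(inE, mem_cat) eqxx !orbT.
- by rewrite /cyc !(inE, mem_cat) eqxx.
- have := IH c (uniq_cyc_l U) H; rewrite /= cyc_node /cyc !(inE, mem_cat).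
  by case/or3P=> ->; rewrite ?orbT.
- move: U; rewrite cyc_node -cat_cons cat_uniq => /and3P[_ /hasPn/(_ a H)].
  by rewrite /= mem_head.
Qed.

Lemma lspine_nbr a t b z : z \in cyc a (lspine t) b ->
  z = a \/ (a, z) \in drt a (lspine t) b.
Proof.
elim: t b => [|t1 IH c t2 _] b.
  by move=> H; rewrite !inE in H; case/orP: H => /eqP->; [left|right; apply: drt_head].
rewrite [lspine _]/= cyc_node_l mem_cat => /orP[/IH[->|H]|H]; first by left.
- by right; apply/in_drt_node/Or43.
- by move: H; rewrite mem_seq1 => /eqP->; right; apply: drt_head.
Qed.

(* [uL t h] adds to the handle [h] all neighbours of the left root; the fan
   [fL t h] hangs at the edge from the left root to [eL h b]. *)
Fixpoint uL t h := match h, t with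
  | Node h1 c h2, Node t1 _ _ => Node (uL t1 h1) c h2
  | _, _ => lspine t
  end.

Fixpoint fL t h := match h, t with
  | Node h1 _ _, Node t1 _ _ => fL t1 h1
  | _, _ => lspine t
  end.

Fixpoint eL h b := if h is Node h1 c _ then eL h1 c else b.

Lemma prune_uL t h : prune h t -> prune (uL t h) t.
Proof.
elim: h t => [|h1 IH1 c h2 _] [|t1 d t2] //=; first by rewrite eqxx prune_lspine.
by case/and3P=> -> /IH1-> ->.
Qed.

Lemma lspine_uL t h : prune h t -> prune (lspine t) (uL t h).
Proof.
elim: h t => [|h1 IH1 c h2 _] [|t1 d t2] //=; first by rewrite eqxx prune_refl.
by case/and3P=> /eqP-> /IH1-> _; rewrite eqxx.
Qed.

Lemma uL_cyc t h a b : prune h t ->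
  cyc a (uL t h) b =i cyc a h b ++ cyc a (fL t h) (eL h b).
Proof.
elim: h t b => [|h1 IH1 c h2 _] t b.
  have -> : uL t Leaf = lspine t by case: t.
  have -> : fL t Leaf = lspine t by case: t.
  by move=> _ x; rewrite /cyc !(mem_cat, inE) /=; do !case: (_ == _) => //=; rewrite ?orbT.
case: t => [//|t1 d t2] /and3P[/eqP Ed /(IH1 t1 c) H1 _] x.
rewrite [uL _ _]/= [fL _ _]/= [eL _ _]/= cyc_node_l mem_cat H1 [cyc a (Node _ _ _) b]cyc_node_l !mem_cat.
by do !case: (_ \in _).
Qed.

Lemma eL_side h a b : sub a h b a Leaf (eL h b).
Proof. by elim: h b => [|h1 IH c h2 _] b /=; constructor. Qed.

Lemma uL_drt t h a b : prune h t ->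
  drt a (uL t h) b =i drt a h b ++ drt a (fL t h) (eL h b).
Proof.
elim: h t b => [|h1 IH1 c h2 _] t b.
  have -> : uL t Leaf = lspine t by case: t.
  have -> : fL t Leaf = lspine t by case: t.
  move=> _ p; rewrite in_drt2; apply/idP/orP => [H|[|//]]; first by right.
  exact: prune_drt.
case: t => [//|t1 d t2] /and3P[/eqP Ed /(IH1 t1 c) H1 _] p.
rewrite [uL _ _]/= [fL _ _]/= [eL _ _]/= in_drt2; apply/idP/orP.
  case/in_drt_node=> [H|H|H|H]; last 1 first.
  - by left; apply/in_drt_node/Or44.
  - by left; apply/in_drt_node/Or41.
  - by left; apply/in_drt_node/Or42.
  - move: H; rewrite H1 in_drt2 => /orP[H|]; last by right.
    by left; apply/in_drt_node/Or43.
case=> [/in_drt_node[H|H|H|H]|H]; apply/in_drt_node.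
- exact: Or41.
- exact: Or42.
- by apply: Or43; rewrite H1 in_drt2 H.
- exact: Or44.
- by apply: Or43; rewrite H1 in_drt2 H orbT.
Qed.

Lemma fL_sub t h a b : uniq (cyc a t b) -> prune h t ->
  exists s, [/\ sub a t b a s (eL h b), fL t h = lspine s &
    {in inner s, forall z, z \notin inner h}].
Proof.
elim: h t b => [|h1 IH1 c h2 _] t b U.
  by move=> _; exists t; split; [constructor|case: (t)|].
case: t U => [//|t1 d t2] U /and3P[/eqP Ed Hp1 Hp2]; subst d.
have [s [Hs Ef Hd]] := IH1 _ _ (uniq_cyc_l U) Hp1.
exists s; split=> //; first exact: sub_l.
move=> z Hz; rewrite mem_cat negb_or Hd //=.
have Hz1 : z \in a :: inner t1 by rewrite inE (sub_inner Hs) ?orbT.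
move: U; rewrite cyc_node -cat_cons cat_uniq => /and3P[_ /hasPn Hn _].
apply/negP=> Hz2; suff : z \notin a :: inner t1 by rewrite Hz1.
apply: Hn; rewrite /cyc !(inE, mem_cat); move: Hz2; rewrite inE => /orP[->//|].
by move/(mem_subseq (prune_subseq Hp2)) ->; rewrite orbT.
Qed.

Lemma empty_proof : [forall A in (set0 : {set {set V}}), (#|A| == 2) && (A \subset (set0 : {set V}))].
Proof. by apply/forall_inP => A; rewrite inE. Qed.

Definition empty_graph : sgraph V := SGraph empty_proof.

(** A fan is empty or has a triangle, so a tree without triangles gives the empty graph instead of a
    bare edge; that edge belongs to the handle anyway. *)
Definition fan_graph a s e : sgraph V :=
  if s is Node _ _ _ then polygon a s e else empty_graph.

Lemma fan_vert a s e x : x \in vert (fan_graph a s e) -> x \in cyc a s e.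
Proof. by case: s => [|s1 c s2]; rewrite inE. Qed.

Lemma fan_vertU (S : {set V}) a s e : a \in S -> e \in S ->
  S :|: vert (fan_graph a s e) = S :|: [set x in cyc a s e].
Proof.
case: s => // Ha He; rewrite setU0; apply/esym/setUidPl/subsetP => x.
by rewrite !inE => /orP[]/eqP->.
Qed.

Lemma fan_edgeU (E : {set {set V}}) a s e : [set a; e] \in E ->
  E :|: edge (fan_graph a s e) = E :|: edge (polygon a s e).
Proof.
case: s => // H; rewrite setU0; apply/esym/setUidPl/subsetP => A.
by rewrite !inE => /andP[/eqP->].
Qed.

Lemma fan_fL (G P : sgraph V) a t c h : uniq (cyc a t c) -> prune h t ->
  (forall x y, (x, y) \in drt a t c -> adj G x y) ->
  {in inner t, forall z, z \in vert P -> z \in inner h} ->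
  adj P a (eL h c) -> fan G P a (fan_graph a (fL t h) (eL h c)).
Proof.
move=> U Hp HG HP Hadj; have [s [Hs Ef Hd]] := fL_sub U Hp.
case: s Hs Ef Hd => [|s1 d s2] Hs Ef Hd; first by left; rewrite Ef /is_empty /= eqxx.
right; rewrite Ef; set s := Node s1 d s2 in Hs Ef Hd *; set e := eL h c in Hs Hadj *.
have -> : fan_graph a (lspine s) e = polygon a (lspine s) e by [].
have Us := sub_uniq Hs U.
have Ul : uniq (cyc a (lspine s) e) := prune_uniq (prune_lspine s) Us.
have Hae : [set a; e] \in edge (polygon a (lspine s) e).
  by apply/edge_polyP => //; exists a, e; rewrite drt_head.
split.
- by apply: outerplanar_path_poly => //; apply: linear_lspine.
- apply/subsetP=> z; rewrite vert_poly in_set => /lspine_nbr[->|H]; first by rewrite !inE eqxx.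
  rewrite in_setU1 in_set; apply/orP; right; apply: HG.
  by apply: (sub_drt Hs); apply: prune_drt H; apply: prune_lspine.
- exists [set a; e]; last by rewrite set21.
  apply/setP=> A; rewrite in_setI in_set1; apply/andP/eqP => [[HA HAP]|-> //].
  have [cA sA] := edge_props HA; have [_ sAP] := edge_props HAP.
  (* A common edge cannot use an inner vertex of the fan, because those avoid the handle. *)
  suff sub : A \subset [set a; e].
    by apply/eqP; rewrite eqEcard sub cA cards2 ltnS leq_b1.
  apply/subsetP=> z Hz; rewrite in_set2.
  have := subsetP sA z Hz; rewrite vert_poly in_set.
  rewrite /cyc in_cons mem_cat mem_seq1 => /or3P[->//|Hzi|->]; last by rewrite orbT.
  have Hzs : z \in inner s := mem_subseq (prune_subseq (prune_lspine s)) Hzi.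
  have Hzt : z \in inner t := sub_inner Hs Hzs.
  by move: (Hd z Hzs); rewrite (HP z Hzt) // (subsetP sAP).
Qed.

Lemma tip_cyc a h b A : tip a h b A -> h <> Leaf -> A \subset [set x in cyc a h b].
Proof.
rewrite /tip => HA Hh; apply: incident_tri_cyc HA.
case: h Hh => // h1 c h2 _; rewrite /tri_sets /=; exact: mem_last.
Qed.

(** The handle is the descent from the root triangle to the triangle at [pq]; cutting everything off
    this descent makes it linear. *)
Lemma handle_exists a t b p q : t <> Leaf -> (p, q) \in sides a t b ->
  exists h, [/\ prune h t, h <> Leaf, linear h & tip a h b [set p; q]].
Proof.
elim: t a b => // t1 IH1 c t2 IH2 a b _; rewrite [sides _ _ _]/= mem_cat => /orP[] H.
  case: t1 IH1 H => [_|s1 d s2 IH1 H].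
    rewrite inE => /eqP[-> ->]; exists (Node Leaf c Leaf); split=> //=; first by rewrite eqxx.
    by rewrite /tip (incident_root a Leaf c Leaf b) eqxx.
  have [//|h [Hp Hh Hl Ht]] := IH1 a c _ H.
  exists (Node h c Leaf); split=> //=; [by rewrite eqxx Hp|by rewrite Hl orbT|].
  move: Ht; rewrite /tip /tri_sets /= map_cat /= cats0.
  by case: h Hh {Hp Hl}.
case: t2 IH2 H => [_|s1 d s2 IH2 H].
  rewrite inE => /eqP[-> ->]; exists (Node Leaf c Leaf); split=> //=; first by rewrite eqxx.
  by rewrite /tip (incident_root a Leaf c Leaf b) setUC eqxx !orbT.
have [//|h [Hp Hh Hl Ht]] := IH2 c b _ H.
exists (Node Leaf c h); split=> //=; first by rewrite eqxx Hp.
  move: Ht; rewrite /tip /tri_sets /=.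
by case: h Hh {Hp Hl}.
Qed.

(** The handle to [pq] is completed by a fan at [a] inside [t1] and, through the mirror image, a fan
    at [b] inside [t2]. These two parts share only the apex [c], so the fans have no common edge. *)
Lemma umbrella_exists a t b p q : uniq (cyc a t b) -> t <> Leaf ->
  (p, q) \in sides a t b -> exists u, [/\ prune u t,
    umbrella (polygon a t b) [set a; b] (polygon a u b),
    p \in cyc a u b, q \in cyc a u b &
    neighbours (polygon a t b) a :|: neighbours (polygon a t b) b
      \subset [set x in cyc a u b]].
Proof.
move=> U Ht Hpq; have [h [Hp Hh Hl Htip]] := handle_exists Ht Hpq.
case: t U Ht Hpq Hp => // t1 c t2 U _ Hpq Hp.
case: h Hp Hh Hl Htip => // h1 c' h2 /and3P[/eqP Ec Hp1 Hp2] _ Hl Htip; subst c'.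
have {}Hp1 : prune h1 t1 := Hp1; have {}Hp2 : prune h2 t2 := Hp2.
set G := polygon a (Node t1 c t2) b; set P := polygon a (Node h1 c h2) b.
have [U1 U2] := (uniq_cyc_l U, uniq_cyc_r U).
have U2' : uniq (cyc b (mir t2) c) by rewrite uniq_mir.
have Hp2' : prune (mir h2) (mir t2) by rewrite prune_mir.
pose u1 := uL t1 h1; pose u2 := mir (uL (mir t2) (mir h2)).
have Hu1 : prune u1 t1 by apply: prune_uL.
have Hu2 : prune u2 t2 by rewrite -prune_mir mirK prune_uL.
pose u := Node u1 c u2; have Hu : prune u (Node t1 c t2) by apply/and3P.
have Hph : prune (Node h1 c h2) (Node t1 c t2) by apply/and3P.
have Uu : uniq (cyc a u b) := prune_uniq Hu U.
have Uh : uniq (cyc a (Node h1 c h2) b) := prune_uniq Hph U.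
pose F1 := fan_graph a (fL t1 h1) (eL h1 c).
pose F2 := fan_graph b (fL (mir t2) (mir h2)) (eL (mir h2) c).
have Cu1 := uL_cyc a c Hp1; have Du1 := uL_drt a c Hp1.
have Cu2 x : (x \in cyc c u2 b) = (x \in cyc c h2 b) || (x \in cyc b (fL (mir t2) (mir h2)) (eL (mir h2) c)).
  by rewrite -mem_mir mirK uL_cyc // mem_cat mem_mir.
have Du2 (d : V * V) : (d \in drt c u2 b) = (d \in drt c h2 b) || (d \in drt b (fL (mir t2) (mir h2)) (eL (mir h2) c)).
  by rewrite -drt_mir mirK uL_drt // in_drt2 drt_mir.
have Cu x : (x \in cyc a u b) = [|| x \in cyc a (Node h1 c h2) b,
    x \in cyc a (fL t1 h1) (eL h1 c) |
    x \in cyc b (fL (mir t2) (mir h2)) (eL (mir h2) c)].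
  have split v1 v2 : (x \in cyc a (Node v1 c v2) b) = (x \in cyc a v1 c) || (x \in cyc c v2 b).
    rewrite cyc_node_l mem_cat; apply/orP/orP=> -[H|H]; [by left|right|by left|].
      by rewrite /cyc in_cons H orbT.
    move: H; rewrite /cyc in_cons => /predU1P[->|H]; last by right.
    by left; rewrite in_cons mem_cat mem_seq1 eqxx !orbT.
  by rewrite !split Cu1 Cu2 mem_cat; do !case: (_ \in _).
have Du (d : V * V) : (d \in drt a u b) = [|| d \in drt a (Node h1 c h2) b,
    d \in drt a (fL t1 h1) (eL h1 c) |
    d \in drt b (fL (mir t2) (mir h2)) (eL (mir h2) c)].
  apply/idP/or3P.
    case/in_drt_node=> [H|H|H|H].
    - by apply: Or31; apply/in_drt_node/Or41.
    - by apply: Or31; apply/in_drt_node/Or42.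
    - move: H; rewrite Du1 in_drt2 => /orP[H|H]; last exact: Or32.
      by apply: Or31; apply/in_drt_node/Or43.
    - move: H; rewrite Du2 => /orP[H|H]; last exact: Or33.
      by apply: Or31; apply/in_drt_node/Or44.
  case=> [/in_drt_node[H|H|H|H]|H|H]; apply/in_drt_node.
  - exact: Or41.
  - exact: Or42.
  - by apply: Or43; rewrite Du1 in_drt2 H.
  - by apply: Or44; rewrite Du2 H.
  - by apply: Or43; rewrite Du1 in_drt2 H orbT.
  - by apply: Or44; rewrite Du2 H orbT.
have Hprune1 x y : (x, y) \in drt a t1 c -> adj G x y.
  by move=> H; rewrite adj_poly //; apply/in_drt_node/Or43.
have Hprune2 x y : (x, y) \in drt b (mir t2) c -> adj G x y.
  by rewrite drt_mir => H; rewrite adj_poly //; apply/in_drt_node/Or44.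
have E1h : (a, eL h1 c) \in drt a h1 c := sub_drt (eL_side h1 a c) (drt_head _ _ _).
have E2h : (b, eL (mir h2) c) \in drt c h2 b.
  by rewrite -drt_mir; apply: (sub_drt (eL_side (mir h2) b c)); apply: drt_head.
have vP x : (x \in vert P) = (x \in cyc a (Node h1 c h2) b) by rewrite vert_poly in_set.
have UN := U; rewrite cyc_node -cat_cons cat_uniq in UN.
case/and3P: UN => _ /hasPn UN _.
have UN1 x : x \in a :: inner t1 -> x \in cyc c t2 b -> False.
  by move=> H1 H2; have := UN x H2; rewrite /= H1.
have fanP1 : fan G P a F1.
  apply: fan_fL => //; last by rewrite adj_poly //; apply/in_drt_node/Or43.
  move=> z Hz; rewrite vP cyc_node -cat_cons mem_cat in_cons => /orP[/predU1P[E|//]|H]; exfalso.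
    by move: (U1); rewrite /cyc /= -E mem_cat Hz.
  apply: (UN1 z); first by rewrite inE Hz orbT.
  exact: (mem_subseq (prune_cyc c b Hp2)).
have fanP2 : fan G P b F2.
  apply: fan_fL => //; last by rewrite adj_poly //; apply/in_drt_node/Or44.
  move=> z; rewrite !inner_mir !mem_rev => Hz.
  have Hz2 : z \in cyc c t2 b by rewrite /cyc in_cons mem_cat Hz orbT.
  rewrite vP cyc_node -cat_cons mem_cat => /orP[H|]; [exfalso|].
    apply: (UN1 z) => //; move: H; rewrite !in_cons => /orP[->//|].
    by move/(mem_subseq (prune_subseq Hp1)) ->; rewrite orbT.
  rewrite /cyc in_cons mem_cat mem_seq1 => /or3P[/eqP E|//|/eqP E]; exfalso; subst z.
    by move: U2; rewrite /cyc /= mem_cat Hz.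
  by move: U2; rewrite /cyc /= cats1 rcons_uniq Hz andbF.
have [s1 [Hs1 Ef1 _]] := fL_sub U1 Hp1.
have [s2 [Hs2 Ef2 _]] := fL_sub U2' Hp2'.
have Uf1 : uniq (cyc a (fL t1 h1) (eL h1 c)).
  by rewrite Ef1; apply: prune_uniq (prune_lspine s1) (sub_uniq Hs1 U1).
have Uf2 : uniq (cyc b (fL (mir t2) (mir h2)) (eL (mir h2) c)).
  by rewrite Ef2; apply: prune_uniq (prune_lspine s2) (sub_uniq Hs2 U2').
have C1 x : x \in vert F1 -> x \in cyc a t1 c.
  move/fan_vert; rewrite Ef1 => H; have := mem_subseq (prune_cyc _ _ (prune_lspine s1)) H.
  by case/sub_cyc: Hs1 => r0 [r1 ->]; rewrite !mem_cat => ->; rewrite orbT.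
have C2 x : x \in vert F2 -> x \in cyc c t2 b.
  move/fan_vert; rewrite Ef2 => H; have := mem_subseq (prune_cyc _ _ (prune_lspine s2)) H.
  by rewrite -(mem_mir c t2 b); case/sub_cyc: Hs2 => r0 [r1 ->]; rewrite !mem_cat => ->; rewrite orbT.
have Pe x y : (x, y) \in drt a (Node h1 c h2) b -> [set x; y] \in edge P.
  by move=> H; apply/edge_polyP => //; exists x, y.
have E1P : (a, eL h1 c) \in drt a (Node h1 c h2) b by apply/in_drt_node/Or43.
have E2P : (b, eL (mir h2) c) \in drt a (Node h1 c h2) b by apply/in_drt_node/Or44.
have HN : neighbours G a :|: neighbours G b \subset [set x in cyc a u b].
  apply/subsetP=> z; rewrite in_setU !in_set !adj_poly // => /orP[H|H].
    apply: (mem_subseq (prune_cyc a b _)) (root_nbr_l U H).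
    by apply/and3P; split=> //; apply: lspine_uL.
  rewrite -(mem_mir a u b); have Um : uniq (cyc b (mir (Node t1 c t2)) a) by rewrite uniq_mir.
  rewrite -drt_mir in H.
  apply: (mem_subseq (prune_cyc b a _)) (root_nbr_l Um H).
  by apply/and3P; split=> //; rewrite -/mir mirK; apply: lspine_uL.
have [Hp' Hq'] : p \in cyc a u b /\ q \in cyc a u b.
  have Hh0 : Node h1 c h2 <> Leaf by [].
  have := tip_cyc Htip Hh0; rewrite subUset !sub1set !in_set => /andP[H1 H2].
  by rewrite !Cu H1 H2.
exists u; split=> //.
- split; first exact: root_non_cutting.
  exists a, b; split=> //; exists P, F1, F2; split=> //.
  + split.
    * apply/andP; split; apply/subsetP=> A.
        by rewrite !vert_poly !in_set; apply: (mem_subseq (prune_cyc a b Hu)).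
      case/(edge_polyP _ Uu)=> x [y [-> Hxy]]; apply/edge_polyP => //.
      by exists x, y; split=> //; apply: (prune_drt Hu).
    * by have [] := @maxouter_poly V u a b Uu.
    * have [Ha He1] := drt_cyc E1P; have [Hb He2] := drt_cyc E2P.
      rewrite fan_vertU ?vP // fan_vertU ?in_setU ?vP ?Hb ?He2 //.
      by apply/setP=> x; rewrite !in_setU vert_poly !in_set Cu orbA.
    * rewrite fan_edgeU ?Pe // fan_edgeU ?in_setU ?Pe //.
      apply/setP=> A; rewrite !in_setU; apply/(edge_polyP _ Uu)/idP.
        case=> x [y [-> ]]; rewrite Du => /or3P[] H; apply/orP.
        - by left; apply/orP; left; apply/edge_polyP => //; exists x, y.
        - by left; apply/orP; right; apply/edge_polyP => //; exists x, y.
        - by right; apply/edge_polyP => //; exists x, y.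
      case/orP=> [/orP[]|] /edge_polyP-/(_ _)[] // x [y [-> H]]; exists x, y; split=> //;
      by rewrite Du H ?orbT.
  + exists [set p; q]; split.
    * exact: sides_non_cutting.
    * apply/eqP=> E.
      have : [set a; b] \subset [set x in cyc a t1 c] \/ [set a; b] \subset [set x in cyc c t2 b].
        move: Hpq; rewrite -E /= mem_cat => /orP[]/sides_prs/prs_cyc[H1 H2];
        [left|right]; by rewrite subUset !sub1set !in_set H1 H2.
      rewrite !subUset !sub1set !in_set => -[/andP[_ Hb]|/andP[Ha _]].
        move: U; rewrite cyc_node_l cat_uniq => /and3P[_ /hasPn/(_ b)].
        by rewrite mem_cat mem_head orbT Hb => /(_ isT).
      by apply: (UN1 a) => //; rewrite mem_head.
    * exact: connects_poly.
  + rewrite -setI_eq0; apply/eqP/setP=> A; rewrite in_setI in_set0.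
    apply/negP=> /andP[HA1 HA2].
    have [cA sA1] := edge_props HA1; have [_ sA2] := edge_props HA2.
    have : A \subset [set c].
      apply/subsetP=> x Hx; rewrite in_set1.
      have Hx1 := C1 x (subsetP sA1 x Hx); have Hx2 := C2 x (subsetP sA2 x Hx).
      move: Hx1; rewrite /cyc -cat_cons mem_cat mem_seq1 => /orP[H|//].
      by case: (UN1 x H Hx2).
    by move/subset_leq_card; rewrite cA cards1.
Qed.

End Prune.

(** * Bounding the depth by the size of bags *)

Section Bags.

Variables (V : finType) (disp : Order.disp_t) (I : orderType disp) (l r : V -> I).
Implicit Types (u w e : V) (x : I) (S A Z : seq V).

Definition meets w x := (l w <= x <= r w)%O.

Definition bag S x : {set V} := [set w in S | meets w x].

(** Half of the condition that two intervals meet: the next one starts before the present one is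
    over. This suffices for a chain to leave no gap to the right. *)
Definition link : rel V := [rel u w | (l w <= r u)%O].

Lemma chain_meets u Z x : path link u Z -> (l u <= x)%O -> (x <= r (last u Z))%O ->
  exists2 w, w \in u :: Z & meets w x.
Proof.
elim: Z u => [|v Z IH] u /=; first by move=> _ H1 H2; exists u; rewrite ?mem_head // /meets H1.
case/andP=> /= Huv Hp Hu Hx; have [Hxu|Hxu] := leP x (r u).
  by exists u; rewrite ?mem_head // /meets Hu.
have [w Hw Hwx] := IH v Hp (le_trans Huv (ltW Hxu)) Hx.
by exists w => //; rewrite inE Hw orbT.
Qed.

(* A chain [u :: Z] keeps one place of every bag from [l u] on, and the chain
   [A] keeps a second one beyond the right end of [e]; no place is left for
   them after [x0] because all of [S] has started by then. *)
Lemma bag_step (C S A Z : seq V) e u x0 T :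
  uniq (S ++ A ++ u :: Z) -> {subset S ++ A ++ u :: Z <= C} -> e \in S ->
  path link e A -> path link u Z ->
  (x0 <= r (last e A))%O -> (x0 <= r (last u Z))%O ->
  {in S, forall w, l w <= x0}%O -> (l u <= x0)%O -> (l e <= r e)%O ->
  (forall x, #|bag C x| + (x < l u)%O <= T) ->
  forall x, #|bag S x| + (r e < x)%O < T.
Proof.
move=> U sub He pA pZ x0A x0Z leS lu Hee K.
have SC x : bag S x \subset bag C x.
  by apply/subsetP=> w; rewrite !inE => /andP[Hw ->]; rewrite sub // mem_cat Hw.
have core x : (x <= x0)%O -> #|bag S x| + (r e < x)%O < T.
  move=> Hx.
  have [NA [NZ NAZ]] : [/\ {in A, forall w, w \notin S} &
      {in u :: Z, forall w, w \notin S} /\ {in u :: Z, forall w, w \notin A}].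
    move: U; rewrite cat_uniq => /and3P[_ /hasPn H1]; rewrite cat_uniq => /and3P[_ /hasPn H2 _].
    split; last split=> // w Hw; first by move=> w Hw; apply: H1; rewrite mem_cat Hw.
    by apply: H1; rewrite mem_cat Hw orbT.
  have [SA SZ] : {subset A <= C} /\ {subset u :: Z <= C}.
    by split=> w Hw; apply: sub; rewrite !mem_cat Hw ?orbT.
  have notS w : w \notin S -> w \notin bag S x by move=> H; rewrite inE (negPf H).
  have inC w : w \in C -> meets w x -> w \in bag C x by move=> H1 H2; rewrite inE H1.
  (* Past its right end [e] no longer meets [x], so the vertex found on the chain belongs to [A],
     outside [S]. *)
  have HA : (r e < x)%O -> exists2 w, w \in A & meets w x.
    move=> Hex; have [w] := chain_meets pA (le_trans Hee (ltW Hex)) (le_trans Hx x0A).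
    rewrite inE => /predU1P[->|]; last by exists w.
    by rewrite /meets (leNgt x) Hex andbF.
  have HZ : (l u <= x)%O -> exists2 w, w \in u :: Z & meets w x.
    by move=> Hux; apply: chain_meets; rewrite // (le_trans Hx).
  have add1 w : w \in bag C x -> w \notin bag S x -> #|bag S x| < #|bag C x|.
    move=> H1 H2; apply: proper_card; apply/properP; split; first exact: SC.
    by exists w.
  have := K x; case: (leP (l u) x) => Hux; case: (ltP (r e) x) => Hex /=; rewrite ?addn0.
  - have [w1 A1 M1] := HA Hex; have [w2 Z2 M2] := HZ Hux.
    move=> K1; apply: leq_trans K1.
    have Hs : w1 |: (w2 |: bag S x) \subset bag C x.
      rewrite !subUset !sub1set SC andbT.
      by apply/andP; split; apply: inC => //; [apply: SA|apply: SZ].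
    have := subset_leq_card Hs; rewrite !cardsU1 notS ?NZ // in_setU1 negb_or notS ?NA //.
    rewrite andbT; have -> : w1 != w2 by apply: contraTneq A1 => ->; exact: NAZ.
    by rewrite addn1.
  - have [w2 Z2 M2] := HZ Hux; move=> K1; apply: leq_trans K1.
    by apply: (add1 w2); [apply: inC; rewrite ?SZ|apply: notS; apply: NZ].
  - have [w1 A1 M1] := HA Hex; move=> K1; apply: leq_trans K1; rewrite !addn1 ltnS.
    by apply: (add1 w1); [apply: inC; rewrite ?SA|apply: notS; apply: NA].
  - by move=> K1; apply: leq_trans K1; rewrite addn1 ltnS subset_leq_card.
(* Beyond [x0] the bag of [S] can only shrink. If the reserved place is needed at [x], either it was
   already counted at [x0], or [e] was alive at [x0] and has left since. *)
move=> x; have [/core//|Hx] := leP x x0.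
have C0 := core x0 (lexx _).
have S0 : bag S x \subset bag S x0.
  apply/subsetP=> w; rewrite !inE => /andP[Hw /andP[_ Hr]].
  by rewrite Hw /meets leS // (le_trans (ltW Hx)).
case: (ltP (r e) x) => Hex; last first.
  by rewrite addn0; apply: leq_ltn_trans (subset_leq_card S0) _; apply: leq_ltn_trans C0; apply: leq_addr.
case: (ltP (r e) x0) C0 => Hex0 C0.
  by apply: leq_ltn_trans C0; rewrite leq_add2r subset_leq_card.
apply: leq_ltn_trans C0; rewrite addn0 addn1; apply: proper_card.
apply/properP; split=> //; exists e.
  by rewrite inE He /meets leS.
by rewrite inE /meets (leNgt x) Hex !andbF.
Qed.

End Bags.

(** Two consecutive entries cannot lie on both sides of a nonempty block that contains neither of
    them. *)
Lemma consecutive_split (T : eqType) (s0 m s1 r0 r1 : seq T) x y p q :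
  r0 ++ p :: q :: r1 = s0 ++ x :: m ++ y :: s1 -> m != [::] -> p \notin m -> q \notin m ->
  (exists r', s0 ++ [:: x] = r0 ++ p :: q :: r') \/
  (exists r', y :: s1 = r' ++ p :: q :: r1).
Proof.
move=> E Nm Np Nq; elim: s0 r0 E => [|z s0 IH] [|z' r0] /= [].
- by case: m Nm Np Nq => //= w m _ _ + _ [E _]; rewrite -E mem_head.
- move=> _ E {Nm}; right; elim: m r0 Np {Nq} E => [|w m IH] r0 Np E; first by exists r0.
  case: r0 E => [|w' r0] [Ew E]; first by move: Np; rewrite Ew mem_head.
  by apply: IH E; move: Np; rewrite inE negb_or => /andP[].
- move=> <-; case: s0 {IH} => [|w s0] [<- E]; left; first by exists [::].
  by exists (s0 ++ [:: x]).
- move=> -> /IH[[r' ->]|[r' ->]]; [left|right]; by exists r'.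
Qed.

(** * Anchor-edges and the pieces that hang at them *)

Section Core.

Variable V : finType.

Lemma side_at t (a b w : V) : w \in cyc a t b ->
  exists z, (w, z) \in sides a t b \/ (z, w) \in sides a t b.
Proof.
elim: t a b => [|t1 IH1 c t2 IH2] a b.
  rewrite !inE => /orP[]/eqP->; [exists b; left|exists a; right]; by rewrite inE.
rewrite cyc_node -cat_cons mem_cat => /orP[H|/IH2[z H]].
  have [|z H1] := IH1 a c; first by rewrite /cyc -cat_cons mem_cat H.
  by exists z; rewrite /= !mem_cat; case: H1 => ->; [left|right].
by exists z; rewrite /= !mem_cat; case: H => ->; rewrite orbT; [left|right].
Qed.

(** Since [A] does not cut the umbrella, it is a side of [u] ([chord_cutting]); since it cuts the
    whole graph, the piece cut off there is not a leaf. *)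
Lemma anchor_sub (a b : V) t u (A : {set V}) : uniq (cyc a t b) -> t <> Leaf ->
  prune u t -> u <> Leaf -> A \in anchor_edges (polygon a t b) (polygon a u b) ->
  exists x s y, [/\ A = [set x; y], sub a t b x s y, s <> Leaf,
    (x \in cyc a u b) /\ (y \in cyc a u b) &
    {in inner s, forall z, z \notin cyc a u b}].
Proof.
move=> U Ht Hu Nu; have Uu := prune_uniq Hu U.
rewrite inE => /andP[/(edge_polyP _ Uu)[x0 [y0 [E0 H0]]] /andP[cG ncU]].
have [x [y [E H]]] : exists x y, A = [set x; y] /\ (x, y) \in prs a u b.
  by move: H0; rewrite drtP => /orP[] H; [exists x0, y0|exists y0, x0]; rewrite // setUC.
have Nab : (x, y) <> (a, b).
  move=> [Ex Ey]; have := root_non_cutting U.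
  have <- : A = [set a; b] by rewrite E Ex Ey.
  by rewrite /non_cutting_edge cG andbF.
have /prsP[s' Hs'] := H.
have Es' : s' = Leaf.
  case: s' Hs' => // s1 c s2 Hs'; have Ns' : Node s1 c s2 <> Leaf by [].
  by have := chord_cutting Uu Hs' Ns' Nab; rewrite -E (negPf ncU).
subst s'; have [s Hs Hd] := prune_side U Hu Hs'.
exists x, s, y; split=> //; last exact: prs_cyc.
move=> Es; subst s; have /sidesP := Hs => /(sides_non_cutting U Ht).
by rewrite /non_cutting_edge -E cG andbF.
Qed.

(** Rerooting at [xy] gives both cut-components. The vertex [a] lies outside the first one, which
    singles it out as hanging and keeps the second from being a bare edge. *)
Lemma hanging_poly (a b x y : V) t s : uniq (cyc a t b) -> sub a t b x s y ->
  s <> Leaf -> a \notin cyc x s y ->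
  hanging_subgraph (polygon a t b) [set a; b] [set x; y] (polygon x s y).
Proof.
move=> U Hs Ns Na; have Us := sub_uniq Hs U.
have [r [Pr Er]] := sub_root U Hs.
have Uxr : uniq (x :: inner s ++ y :: inner r) by rewrite -(perm_uniq Pr).
have Ur : uniq (cyc y r x).
  rewrite -(rot_uniq (size (y :: inner r))) /cyc -cat_cons rot_size_cat.
  by apply: subseq_uniq Uxr; rewrite /= eqxx suffix_subseq.
have Nr : r <> Leaf.
  move=> E; move: Na; have : a \in cyc a t b by rewrite mem_head.
  by rewrite (perm_mem Pr) E => ->.
split.
  apply/negP=> /edge_props[_ /subsetP/(_ a)]; rewrite set21 vert_poly in_set (negPf Na).
  by move/(_ isT).
exists (polygon y r x).
have memG z : (z \in cyc a t b) = (z \in cyc x s y) || (z \in cyc y r x).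
  rewrite (perm_mem Pr) /cyc !(in_cons, mem_cat, mem_seq1).
  by case: (z == x); case: (z == y); rewrite ?orbT ?orbF //= orbC.
have subd S c d : uniq (cyc c S d) -> {subset cyc c S d <= cyc a t b} ->
    {subset drt c S d <= drt a t b} -> subgraph (polygon c S d) (polygon a t b).
  move=> Uc H1 H2; apply/andP; split; apply/subsetP=> A.
    by rewrite !vert_poly !in_set; apply: H1.
  case/(edge_polyP _ Uc)=> u [v [-> H]]; apply/edge_polyP => //.
  by exists u, v; split=> //; apply: H2.
split.
- split; try exact: maxouter_poly.
  + by apply: subd => //= z H; rewrite ?memG ?H // Er in_drt2 H.
  + by apply: subd => //= z H; rewrite ?memG ?H ?orbT // Er in_drt2 H orbT.
- apply/setP=> z; rewrite in_setI !vert_poly !in_set.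
  rewrite !in_set1 /cyc !in_cons !mem_cat !mem_seq1.
  have [->|Nx] := eqVneq z x; first by rewrite ?orbT.
  have [->|Ny] := eqVneq z y; first by rewrite ?orbT.
  rewrite /= !orbF; apply/andP => -[H1 H2]; move: Uxr.
  rewrite -cat_cons cat_uniq => /and3P[_ /hasPn/(_ z)].
  by rewrite in_cons H2 orbT /= in_cons H1 orbT => /(_ isT).
- by apply/setP=> z; rewrite in_setU !vert_poly !in_set memG.
- apply/setP=> A; rewrite in_setU; apply/idP/(edge_polyP _ U).
    by case/orP=> /edge_polyP-/(_ _)[] // u [v [-> H]]; exists u, v; rewrite Er in_drt2 H ?orbT.
  case=> u [v [-> ]]; rewrite Er in_drt2 => /orP[] H; apply/orP; [left|right];
  by apply/edge_polyP => //; exists u, v.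
Qed.

End Core.

(** * Bags of a hanging piece *)

Section Depth.

Variable V : finType.

Lemma rev_link d (I : orderType d) (l r : V -> I) (s : seq V) :
  (forall u v, (u, v) \in zip s (behead s) -> link l r u v && link l r v u) ->
  sorted (link l r) s /\ sorted (link l r) (rev s).
Proof.
elim: s => [//|u [|v s] IH] H //.
have [|S1 S2] := IH; first by move=> x y Hxy; apply: H; rewrite /= inE Hxy orbT.
have /andP[L1 L2] : link l r u v && link l r v u by apply: H; rewrite inE eqxx.
split; first by rewrite /= L1.
rewrite rev_cons; case E: (rev (v :: s)) => [|z w]; first by rewrite rev_cons in E; case: (rev s) E.
rewrite /= rcons_path; move: S2; rewrite E /= => ->.
have -> // : last z w = v.
by have := congr1 (last v) E; rewrite rev_cons last_rcons.
Qed.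

(* On the outer cycle the end [pq] of the handle lies before [x] or after [y];
   [e] is the one of [x] and [y] from which the cycle reaches [pq] outside the
   hanging piece, while [u0] reaches [pq] the other way round. *)
Lemma hanging_bags d (I : orderType d) (l r : V -> I) (a b x y p q u0 : V) t s x0 T :
  uniq (cyc a t b) -> (p, q) \in sides a t b -> sub a t b x s y -> s <> Leaf ->
  a \notin cyc x s y -> b \notin cyc x s y ->
  p \notin inner s -> q \notin inner s ->
  {in cyc a t b, forall w, (l w <= r w)%O} ->
  (forall u v, (u, v) \in drt a t b -> (l u <= r v)%O) ->
  {in cyc a t b, forall w, (l w <= x0)%O} -> (x0 <= r p)%O -> (x0 <= r q)%O ->
  u0 \in [:: a; b] ->
  (forall x, #|bag l r (cyc a t b) x| + (x < l u0)%O <= T) ->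
  exists2 e, e \in [:: x; y] & forall z, #|bag l r (cyc x s y) z| + (r e < z)%O < T.
Proof.
move=> U Hpq Hs Ns Na Nb Np Nq Hlr Hadj Hx0 Hp Hq Hu0 K.
have [s0 [s1 Es]] := sub_cyc Hs.
have /sidesP/sub_cyc[r0 [r1 Er]] := Hpq.
have Hlink u v : (u, v) \in drt a t b -> link l r u v && link l r v u.
  by move=> H; rewrite /link /= !Hadj // drt_sym.
have Hcons u v w1 w2 : cyc a t b = w1 ++ u :: v :: w2 -> link l r u v && link l r v u.
  move=> E; apply: Hlink; rewrite -(perm_mem (tri_darts_perm a t b)) mem_cat.
  apply/orP; right; rewrite arcsE //; apply/mapP; exists u.
    by rewrite E mem_cat mem_head orbT.
  by rewrite E next_mid // -E.
have Hsort w1 w w2 : cyc a t b = w1 ++ w ++ w2 ->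
    sorted (link l r) w /\ sorted (link l r) (rev w).
  move=> E; apply: rev_link => u v Huv.
  have [v1 [v2 Ev]] : exists v1 v2, w = v1 ++ u :: v :: v2.
    elim: (w) Huv => [//|z [//|z' w'] IH] /=; rewrite inE => /predU1P[[-> ->]|/IH[v1 [v2 E']]].
      by exists [::], w'.
    by exists (z :: v1), v2; rewrite /= -E'.
  by apply: (Hcons u v (w1 ++ v1) (v2 ++ w2)); rewrite E Ev -!catA.
have Hab : link l r a b && link l r b a by apply: Hlink; apply: drt_head.
have Es' : cyc a t b = s0 ++ x :: inner s ++ y :: s1 by rewrite Es /cyc /= -catA.
have Er' : cyc a t b = r0 ++ p :: q :: r1 by [].
have E2 : r0 ++ p :: q :: r1 = s0 ++ x :: inner s ++ y :: s1 by rewrite -Er' Es'.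
have Ni : inner s != [::] by case: (s) Ns => // s2 c s3 _ /=; case: (inner s2).
have [[r' E3]|[r' E3]] := consecutive_split E2 Ni Np Nq.
(* Here [pq] precedes [x]: one chain runs forward from [a] to [p], the other backward from [x] to
   [q]. *)
- have Eq : q :: r' = rcons (belast q r') x.
    have lx : last q r' = x by have := congr1 (last x) E3; rewrite !last_cat.
    by rewrite -[in RHS]lx -lastI.
  have [s1' Es1] : exists s1', s1 = rcons s1' b.
    have := congr1 (last b) Es; rewrite /cyc /= !last_cat /= ?last_cat /=.
    case/lastP: (s1) => [/= E|s1' z]; last by rewrite last_rcons => ->; exists s1'.
    by move: Nb; rewrite E /cyc in_cons mem_cat mem_seq1 eqxx !orbT.
  set r2 := belast q r' in Eq.
  have Ec : cyc a t b = (r0 ++ [:: p]) ++ rcons r2 x ++ inner s ++ y :: s1.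
    by rewrite Es' -cat_rcons -cats1 E3 -Eq -!catA /= -?catA.
  (* The list contains both [a] and [b], so that it serves for either value of [u0]. *)
  have P : perm_eq (cyc a t b) ((cyc x s y ++ rev r2 ++ b :: r0 ++ [:: p]) ++ s1').
    rewrite Ec Es1; apply/seq.permP=> f; rewrite /cyc -!cats1 /= ?(count_cat, count_rev) /= ?(count_cat, count_rev) /= ?(count_cat, count_rev) /=.
    by do !move: (nat_of_bool _); do !move: (count f _); clear; lia.
  have [Z EZ] : exists Z, r0 ++ [:: p] = a :: Z.
    move: Er'; rewrite /cyc; case: (r0) => [|c r3] [<- _]; first by exists [::].
    by exists (r3 ++ [:: p]).
  rewrite EZ in P Ec.
  have pZ : path (link l r) a Z by have [] := Hsort [::] _ _ Ec.
  have lZ : last a Z = p by have := congr1 (last a) EZ; rewrite last_cat /= => <-.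
  have pA : path (link l r) x (rev r2).
    by have [_] := Hsort _ _ _ Ec; rewrite rev_rcons.
  have lA : last x (rev r2) = q.
    move: Eq; case: (r2) => [|z w] [-> _] //=; by rewrite rev_cons last_rcons.
  have UP := U; rewrite (perm_uniq P) cat_uniq in UP; case/andP: UP => UP _.
  have subP : {subset cyc x s y ++ rev r2 ++ b :: a :: Z <= cyc a t b}.
    by move=> w Hw; rewrite (perm_mem P) mem_cat Hw.
  have xC : x \in cyc a t b by apply: subP; rewrite mem_cat mem_head.
  have [aC bC] : a \in cyc a t b /\ b \in cyc a t b.
    by split; apply: subP; rewrite !mem_cat !inE eqxx !orbT.
  exists x; first by rewrite mem_head.
  have HS : {in cyc x s y, forall w, (l w <= x0)%O}.
    by move=> w Hw; apply: Hx0; apply: subP; rewrite mem_cat Hw.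
  move: Hu0; rewrite !inE => /orP[]/eqP Eu; subst u0.
  + apply: (@bag_step V d I l r (cyc a t b) (cyc x s y) (rev r2) Z x a x0); rewrite ?lA ?lZ ?mem_head //.
    * apply: subseq_uniq UP; apply: cat_subseq => //; apply: cat_subseq => //.
      exact: subseq_cons.
    * move=> w Hw; apply: subP; move: Hw; rewrite !mem_cat => /or3P[->|->|Hw]; rewrite ?orbT //.
      by rewrite (in_cons b) Hw !orbT.
    * exact: Hx0.
    * exact: Hlr.
  (* From [b] the chain first crosses the root edge to [a]. *)
  + apply: (@bag_step V d I l r (cyc a t b) (cyc x s y) (rev r2) (a :: Z) x b x0); rewrite ?lA ?mem_head //.
    * by case/andP: Hab => _ /= ->.
    * by rewrite /= lZ.
    * exact: Hx0.
    * exact: Hlr.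
(* Here [pq] follows [y]: one chain runs forward from [y] to [p], the other backward from [b] to
   [q]. *)
- have [s0' Es0] : exists s0', s0 = a :: s0'.
    move: Es'; rewrite /cyc; case: (s0) => [|c s0'] [Ea _]; last by exists s0'; rewrite Ea.
    by move: Na; rewrite Ea mem_head.
  have [A EA] : exists A, r' ++ [:: p] = y :: A.
    move: E3; case: (r') => [|c r3] [-> _]; first by exists [::].
    by exists (r3 ++ [:: p]).
  have Eb : q :: r1 = rcons (belast q r1) b.
    have lb : last q r1 = b by have := congr1 (last b) Er'; rewrite /cyc /= !last_cat.
    by rewrite -[in RHS]lb -lastI.
  set r2 := belast q r1 in Eb.
  have Ec : cyc a t b = (s0 ++ x :: inner s) ++ (y :: A) ++ rcons r2 b.
    by rewrite Es' E3 -EA -Eb -!catA.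
  have P : perm_eq (cyc a t b) ((cyc x s y ++ A ++ a :: b :: rev r2) ++ s0').
    rewrite Ec Es0; apply/seq.permP=> f; rewrite /cyc -!cats1 /= ?(count_cat, count_rev) /= ?(count_cat, count_rev) /= ?(count_cat, count_rev) /=.
    by do !move: (nat_of_bool _); do !move: (count f _); clear; lia.
  have pA : path (link l r) y A by have [] := Hsort _ _ _ Ec.
  have lA : last y A = p by have := congr1 (last y) EA; rewrite last_cat /= => <-.
  have pZ : path (link l r) b (rev r2).
    have E4 : cyc a t b = ((s0 ++ x :: inner s) ++ (y :: A)) ++ rcons r2 b ++ [::].
      by rewrite cats0 Ec catA.
    by have [_] := Hsort _ _ _ E4; rewrite rev_rcons.
  have lZ : last b (rev r2) = q.
    move: Eb; case: (r2) => [|z w] [-> _] //=; by rewrite rev_cons last_rcons.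
  have UP := U; rewrite (perm_uniq P) cat_uniq in UP; case/andP: UP => UP _.
  have subP : {subset cyc x s y ++ A ++ a :: b :: rev r2 <= cyc a t b}.
    by move=> w Hw; rewrite (perm_mem P) mem_cat Hw.
  have yS : y \in cyc x s y by rewrite /cyc in_cons mem_cat mem_head !orbT.
  have yC : y \in cyc a t b by apply: subP; rewrite mem_cat yS.
  have [aC bC] : a \in cyc a t b /\ b \in cyc a t b.
    by split; apply: subP; rewrite !mem_cat !inE eqxx !orbT.
  exists y; first by rewrite !inE eqxx orbT.
  have HS : {in cyc x s y, forall w, (l w <= x0)%O}.
    by move=> w Hw; apply: Hx0; apply: subP; rewrite mem_cat Hw.
  move: Hu0; rewrite !inE => /orP[]/eqP Eu; subst u0.
  + apply: (@bag_step V d I l r (cyc a t b) (cyc x s y) A (b :: rev r2) y a x0); rewrite ?lA //.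
    * by case/andP: Hab => /= ->.
    * by rewrite /= lZ.
    * exact: Hx0.
    * exact: Hlr.
  + apply: (@bag_step V d I l r (cyc a t b) (cyc x s y) A (rev r2) y b x0); rewrite ?lA ?lZ //.
    * apply: subseq_uniq UP; apply: cat_subseq => //; apply: cat_subseq => //.
      exact: subseq_cons.
    * move=> w Hw; apply: subP; move: Hw; rewrite !mem_cat => /or3P[->|->|Hw]; rewrite ?orbT //.
      by rewrite (in_cons a) Hw !orbT.
    * exact: Hx0.
    * exact: Hlr.
Qed.

End Depth.

(** * The induction on the size of bags *)

Section Bound.

Variable V : finType.

(** The latest of the three starts lies in all three intervals, since they meet pairwise. *)
Lemma bag_triangle d (I : orderType d) (l r : V -> I) (a b : V) t :
  uniq (cyc a t b) -> t <> Leaf ->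
  {in cyc a t b, forall w, (l w <= r w)%O} ->
  (forall u v, (u, v) \in drt a t b -> (l u <= r v)%O) ->
  exists x, 3 <= #|bag l r (cyc a t b) x|.
Proof.
case: t => // t1 c t2 U _ Hlr Hadj.
have Dab := drt_head a (Node t1 c t2) b.
have Dac : (a, c) \in drt a (Node t1 c t2) b by apply/in_drt_node/Or43/drt_head.
have Dcb : (c, b) \in drt a (Node t1 c t2) b by apply/in_drt_node/Or44/drt_head.
have [[Ca Cb] [_ Cc]] := (drt_cyc Dab, drt_cyc Dac).
have [Dba [Dca Dbc]] : (b, a) \in drt a (Node t1 c t2) b /\
    (c, a) \in drt a (Node t1 c t2) b /\ (b, c) \in drt a (Node t1 c t2) b.
  by rewrite drt_sym Dab drt_sym Dac drt_sym Dcb.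
exists (Order.max (l a) (Order.max (l b) (l c))).
have S3 : [set a; b; c] \subset bag l r (cyc a (Node t1 c t2) b) (Order.max (l a) (Order.max (l b) (l c))).
  rewrite !subUset !sub1set !in_set Ca Cb Cc /meets !ge_max !le_max !lexx ?orbT /=.
  by rewrite !Hlr // !Hadj.
apply: leq_trans (subset_leq_card S3).
have [Nab [Nac Ncb]] : a != b /\ a != c /\ c != b.
  by rewrite !(drt_neq U).
have -> : [set a; b; c] = c |: [set a; b] by rewrite setUC.
by rewrite cardsU1 cards2 !inE !negb_or (eq_sym c a) Nac Ncb Nab.
Qed.

(* The place kept free left of [u0] belongs to the path on which the ambient
   graph leaves [u0].  The handle ends at the vertex that starts last, so for a
   hanging piece the free place is on the right; the induction therefore passes
   to the dual order. *)
Lemma depth_bound T d (I : orderType d) (l r : V -> I) (a b u0 : V) t :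
  uniq (cyc a t b) -> t <> Leaf ->
  {in cyc a t b, forall w, (l w <= r w)%O} ->
  (forall u v, (u, v) \in drt a t b -> (l u <= r v)%O) ->
  u0 \in [:: a; b] ->
  (forall x, #|bag l r (cyc a t b) x| + (x < l u0)%O <= T) ->
  exists2 k, umbrella_system (polygon a t b) [set a; b] k & k.+2 <= T.
Proof.
elim: T d I l r a b u0 t => [|T IH] d I l r a b u0 t U Ht Hlr Hadj Hu0 K.
  have [x] := bag_triangle U Ht Hlr Hadj.
  by have := K x; rewrite leqn0 addn_eq0 => /andP[/eqP-> _].
have T3 : 3 <= T.+1.
  have [x Hx] := bag_triangle U Ht Hlr Hadj.
  by apply: leq_trans Hx (leq_trans (leq_addr _ _) (K x)).
have Ca : a \in cyc a t b by rewrite mem_head.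
have [w Cw Hw] := @arg_maxP _ I V a (mem (cyc a t b)) l Ca.
have {}Cw : w \in cyc a t b := Cw.
have Hmax : {in cyc a t b, forall v, (l v <= l w)%O} by move=> v Hv; apply: Hw.
have [p [q [Hpq [Hp Hq]]]] : exists p q, (p, q) \in sides a t b /\ (l w <= r p)%O /\ (l w <= r q)%O.
  have [z [Hz|Hz]] := side_at Cw.
    by exists w, z; split=> //; rewrite Hlr // Hadj // drtP sides_prs.
  by exists z, w; split=> //; rewrite Hlr // Hadj // drtP (sides_prs Hz) orbT.
have [u [Hu HU Pu Qu HN]] := umbrella_exists U Ht Hpq.
have Nu : u <> Leaf.
  move=> Eu; have [z Hz] : exists z, (a, z) \in drt a t b /\ z \notin cyc a u b.
    case: (t) U Ht => // t1 c t2 U0 _; exists c.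
    have Dac : (a, c) \in drt a (Node t1 c t2) b by apply/in_drt_node/Or43/drt_head.
    have Dcb : (c, b) \in drt a (Node t1 c t2) b by apply/in_drt_node/Or44/drt_head.
    split=> //; rewrite Eu !inE negb_or (drt_neq U0 Dcb) eq_sym.
    by rewrite (drt_neq U0 Dac).
  case: Hz => Hz /negP; apply; have := subsetP HN z.
  by rewrite in_setU !in_set !adj_poly // Hz => /(_ isT).
have HNv v z : v \in [:: a; b] -> (v, z) \in drt a t b -> z \in cyc a u b.
  move=> Hv Hz; have := subsetP HN z; rewrite in_setU !in_set !adj_poly //.
  move: Hv; rewrite !inE => /orP[]/eqP E; rewrite E in Hz;
  by rewrite Hz ?orbT => /(_ isT).
have step A : A \in anchor_edges (polygon a t b) (polygon a u b) -> exists Sd : sgraph V * nat,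
    [/\ hanging_subgraph (polygon a t b) [set a; b] A Sd.1,
        umbrella_system Sd.1 A Sd.2 & Sd.2.+2 <= T].
  case/(anchor_sub U Ht Hu Nu)=> x [s [y [-> Hs Ns [Cx Cy] Hd]]].
  have Us := sub_uniq Hs U.
  (* If a root were [x] or [y], the apex [e] of the hanging triangle at [xy] would be its neighbour
     and hence belong to the umbrella. *)
  have root_out v : v \in [:: a; b] -> v \notin cyc x s y.
    move=> Hv; have Cv : v \in cyc a u b.
      by move: Hv; rewrite !inE mem_cat inE => /orP[]->; rewrite ?orbT.
    case: s Hs Ns Hd {Us} => // s1 e s2 Hs _ Hd.
    have He : e \in inner (Node s1 e s2) by rewrite mem_cat mem_head orbT.
    rewrite /cyc in_cons mem_cat mem_seq1 !negb_or; apply/and3P; split.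
    - apply: contraTneq He => Ev; apply: contraTN (HNv v e Hv _); first exact: Hd.
      by rewrite Ev; apply: (sub_drt Hs); apply/in_drt_node/Or43/drt_head.
    - by apply: contraTN Cv; apply: Hd.
    - apply: contraTneq He => Ev; apply: contraTN (HNv v e Hv _); first exact: Hd.
      by rewrite Ev drt_sym; apply: (sub_drt Hs); apply/in_drt_node/Or44/drt_head.
  have [Na Nb] : a \notin cyc x s y /\ b \notin cyc x s y.
    by split; apply: root_out; rewrite !inE eqxx ?orbT.
  have [e He Ke] : exists2 e, e \in [:: x; y] &
      forall z, #|bag l r (cyc x s y) z| + (r e < z)%O < T.+1.
    apply: (hanging_bags U Hpq Hs Ns Na Nb _ _ Hlr Hadj Hmax Hp Hq Hu0 K).
      by apply: contraTN Pu; apply: Hd.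
    by apply: contraTN Qu; apply: Hd.
  have [s0 [s1 Es]] := sub_cyc Hs.
  have sC : {subset cyc x s y <= cyc a t b}.
    by move=> z Hz; rewrite Es !mem_cat Hz orbT.
  (* In the dual order intervals start at [r], so the place kept right of [r e] is one kept before
     the start of [e]. *)
  have [|||k Hk kT] := IH _ (I^d)%type r l x y e s Us Ns _ _ He.
  - by move=> z /sC; apply: Hlr.
  - by move=> v z Hvz; apply: Hadj; rewrite drt_sym; apply: (sub_drt Hs).
  - move=> z; have := Ke z; rewrite ltnS; congr (_ + _ <= T).
    by apply: eq_card => v; rewrite !in_set; congr andb; apply: andbC.
  by exists (polygon x s y, k); split=> //; apply: hanging_poly.
have [Sd HSd] : exists Sd : {set V} -> sgraph V * nat,
    forall A, A \in anchor_edges (polygon a t b) (polygon a u b) ->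
    [/\ hanging_subgraph (polygon a t b) [set a; b] A (Sd A).1,
        umbrella_system (Sd A).1 A (Sd A).2 & (Sd A).2.+2 <= T].
  (* Finite choice over all vertex sets; off the anchor-edges any pair will do. *)
  apply: (@fin_all_exists _ (fun _ => (sgraph V * nat)%type)
    (fun A Sd => A \in anchor_edges (polygon a t b) (polygon a u b) ->
    [/\ hanging_subgraph (polygon a t b) [set a; b] A Sd.1,
        umbrella_system Sd.1 A Sd.2 & Sd.2.+2 <= T])) => A.
  case: (boolP (A \in anchor_edges (polygon a t b) (polygon a u b))) => [/step[Sd H]|_].
    by exists Sd.
  by exists (polygon a t b, 0).
exists (1 + \max_(A in anchor_edges (polygon a t b) (polygon a u b)) (Sd A).2).
  apply: (@UmbrellaSystem V _ _ _ (fun A => (Sd A).1) (fun A => (Sd A).2)) => //.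
    by move=> A /HSd[].
  by move=> A /HSd[].
(* Subtraction is truncated: [T3] gives [2 <= T], which is needed when there is no anchor-edge. *)
have : \max_(A in anchor_edges (polygon a t b) (polygon a u b)) (Sd A).2 <= T - 2.
  by apply/bigmax_leqP => A /HSd[_ _]; lia.
move: T3; lia.
Qed.

End Bound.

(** * Flat visibility representations *)

Section Layers.

Variables (R : realFieldType) (V : finType) (G : sgraph V) (D : drawing R V).
Hypotheses (HF : flat_visibility_representation G D) (HP : planar_drawing G D).

Local Notation I := (R *l int)%type.

Local Notation xl v := (x1 (vseg D v)).
Local Notation xr v := (x2 (vseg D v)).
Local Notation yy v := (y1 (vseg D v)).

Lemma vseg_le v : v \in vert G -> (xl v <= xr v)%R.
Proof. by case: HF => H _ _ /H/andP[]. Qed.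

Lemma on_vseg v x y : v \in vert G ->
  on_segment (vseg D v) (x, y) = (xl v <= x <= xr v)%R && (y == (yy v)%:~R)%R.
Proof.
case: HF => H _ _ /H/andP[_ /eqP E]; rewrite /on_segment /= -E.
by rewrite -eq_le eq_sym.
Qed.

Lemma layer_disjoint u v : u \in vert G -> v \in vert G -> u != v -> yy u = yy v ->
  (xl u <= xl v)%R -> (xr u < xl v)%R.
Proof.
move=> Hu Hv Nuv Ey Hx; rewrite ltNge; apply/negP=> Hx'.
case: HP => /(_ u v Hu Hv Nuv (xl v, (yy v)%:~R)%R) + _ _.
by rewrite !on_vseg // Ey eqxx Hx Hx' lexx vseg_le.
Qed.

(** The [+ 1] puts this strictly to the right of every vertex segment. *)
Definition xmax : R := (\big[Num.max/0]_(v in vert G) xr v + 1)%R.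

(* The next vertex on the layer of [u] starts here; [xmax] stands in when [u] is
   the last one. *)
Definition xnext u : R :=
  (\big[Order.min/xmax]_(v in vert G | (yy v == yy u) && (xl u < xl v)) xl v)%R.

Lemma xr_max v : v \in vert G -> (xr v < xmax)%R.
Proof.
move=> Hv; rewrite /xmax ltr_pwDr // .
by apply: (le_bigmax_cond _ (fun v => xr v) Hv).
Qed.

Lemma xnext_le u v : v \in vert G -> yy v = yy u -> (xl u < xl v)%R ->
  (xnext u <= xl v)%R.
Proof. by move=> Hv Ey Hx; apply: bigmin_le_cond; rewrite Hv Ey eqxx. Qed.

(** Strictness matters: it lets positions on different layers be compared by [x] alone
    ([pos_lt]). *)
Lemma xr_next u : u \in vert G -> (xr u < xnext u)%R.
Proof.
move=> Hu; apply: lt_bigmin => [|v /and3P[Hv /eqP Ey Hx]]; first exact: xr_max.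
by apply: layer_disjoint => //; [apply: contraTneq Hx => ->; rewrite ltxx|apply: ltW].
Qed.

Lemma le_xnext u z : (z <= xmax)%R ->
  (forall v, v \in vert G -> yy v = yy u -> (xl u < xl v)%R -> (z <= xl v)%R) ->
  (z <= xnext u)%R.
Proof. by move=> Hz H; apply: le_bigmin => // v /and3P[Hv /eqP Ey Hx]; apply: H. Qed.

(* Positions are ordered lexicographically, first by [x] and then by layer, so
   that at every position at most one layer passes from a vertex to the next;
   hence bags have at most [H + 1] vertices. *)
Definition pos_l v : I := (xl v, yy v).
Definition pos_r v : I := (xnext v, yy v).

Lemma pos_lt x1 x2 (k1 k2 : int) : (x1 < x2)%R -> ((x1, k1) <= (x2, k2) :> I)%O.
Proof. by move=> H; rewrite lexi_pair (ltW H) /= leNgt H. Qed.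

Lemma pos_le v : v \in vert G -> (pos_l v <= pos_r v)%O.
Proof. by move=> Hv; apply: pos_lt; apply: le_lt_trans (vseg_le Hv) (xr_next Hv). Qed.

(** The segments joined by a vertical edge overlap in [x]. Along a horizontal edge, a vertex [w]
    starting between [v] and [u] would be hit by the edge, so the interval of [v] reaches at least
    the start of [u]. *)
Lemma pos_adj u v : u \in vert G -> v \in vert G -> u != v -> adj G u v ->
  (pos_l u <= pos_r v)%O.
Proof.
move=> Hu Hv Nuv Huv.
have [_ /(_ _ Huv) Hhv /(_ _ _ Huv)] := HF.
set e := eseg D _ in Hhv *; rewrite /joins !on_vseg // !eqr_int => J.
have [Hux Hvx] : (xl u <= x1 e <= xr u /\ xl v <= x2 e <= xr v \/
    xl v <= x1 e <= xr v /\ xl u <= x2 e <= xr u)%R /\ 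
    (y1 e = yy u /\ y2 e = yy v \/ y1 e = yy v /\ y2 e = yy u).
  by case/orP: J => /andP[/andP[H1 /eqP H2] /andP[H3 /eqP H4]]; auto.
case/orP: Hhv => [/andP[Hx /eqP Ey]|/andP[/eqP Ex _]]; last first.
  have H : (xl u <= xr v)%R.
    by case: Hux => -[/andP[H1 H2] /andP[H3 H4]]; [apply: le_trans H1 _; rewrite Ex|
      apply: le_trans H3 _; rewrite -Ex].
  by apply: pos_lt; apply: le_lt_trans H (xr_next Hv).
have Eyuv : yy u = yy v by case: Hvx => -[<- <-].
have Eye : y1 e = yy v by case: Hvx => -[H1 H2]; rewrite // H1.
rewrite lexi_pair /= Eyuv lexx implybT andbT.
apply: le_xnext => [|w Hw Ew Hvw].
  exact: le_trans (vseg_le Hu) (ltW (xr_max Hu)).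
rewrite leNgt; apply/negP=> Hwu.
have Nvw : v != w by apply: contraTneq Hvw => ->; rewrite ltxx.
have Nuw : u != w by apply: contraTneq Hwu => ->; rewrite ltxx.
have Hvw' : (xr v < xl w)%R by apply: layer_disjoint => //; apply: ltW.
(* An edge segment from [u] to [v] would have to run leftwards; one from [v] to [u] covers the left
   end of [w]. *)
case: Hux => -[/andP[H1 H2] /andP[H3 H4]].
  have := lt_le_trans (le_lt_trans H4 (lt_trans Hvw' Hwu)) (le_trans H1 Hx).
  by rewrite ltxx.
case: HP => _ /(_ w [set u; v] Hw Huv) + _.
rewrite in_set2 !(eq_sym w) (negPf Nuw) (negPf Nvw) => /(_ isT (xl w, (yy w)%:~R)%R).
rewrite on_vseg // eqxx lexx vseg_le //= /on_segment /= -/e -Ey Eye Ew lexx.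
by rewrite (ltW (le_lt_trans H2 Hvw')) (le_trans (ltW Hwu)).
Qed.

(** Apart from the at most one vertex that starts exactly at [z], a bag has at most one vertex per
    layer. *)
Lemma bag_layers (ks : seq int) z : uniq ks ->
  (forall v, v \in vert G -> yy v \in ks) ->
  #|[set v in vert G | (pos_l v <= z <= pos_r v)%O]| <= (size ks).+1.
Proof.
case: z => x k Uk Hk; set B := [set v in _ | _].
(* two vertices of a layer meet [(x, k)] only if the second one starts there *)
pose E := [set v in vert G | (yy v == k) && (xl v == x)%R].
have cE : #|E| <= 1.
  apply/card_le1_eqP => u v; rewrite !inE => /and3P[Hu /eqP Ku /eqP Xu] /and3P[Hv /eqP Kv /eqP Xv].
  apply/eqP; apply: contraT => Nuv.
  have := @layer_disjoint u v Hu Hv; rewrite eq_sym Nuv Ku Kv Xu Xv lexx.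
  move=> /(_ isT erefl isT) H; have := vseg_le Hu; rewrite Xu leNgt.
  by rewrite H.
have inj : {in B :\: E &, injective (fun v => yy v)}.
  move=> u v; rewrite !in_setD => /andP[NEu Bu] /andP[NEv Bv] Ey.
  wlog Hx : u v NEu Bu NEv Bv Ey / (xl u <= xl v)%R.
    by move=> W; have [H|/ltW H] := leP (xl u) (xl v); [apply: W|apply/esym/W].
  apply/eqP; apply: contraT => Nuv.
  have [Hu Hv] : u \in vert G /\ v \in vert G.
    by move: Bu Bv; rewrite !inE => /andP[-> _] /andP[-> _].
  have Hxs : (xl u < xl v)%R := le_lt_trans (vseg_le Hu) (layer_disjoint Hu Hv Nuv Ey Hx).
  have Hn := xnext_le Hv (esym Ey) Hxs.
  move: Bu Bv; rewrite !in_set => /andP[_ /andP[_ Bu]] /andP[_ /andP[Bv _]].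
  move: Bu Bv; rewrite /pos_l /pos_r !lexi_pair => /andP[Bu1 Bu2] /andP[Bv1 Bv2].
  have Exn : x = xnext u by apply/le_anti; rewrite Bu1 (le_trans Hn).
  have Exv : xl v = x by apply/le_anti; rewrite Bv1 Exn Hn.
  move: NEv; rewrite inE Hv Exv eqxx andbT /=; case/eqP; apply/le_anti.
  move: Bu2 Bv2; rewrite -Exn Exv lexx /= Ey => -> -> //.
have : #|B :\: E| <= size ks.
  rewrite cardE -(size_map (fun v => yy v)); apply: uniq_leq_size.
    rewrite map_inj_in_uniq ?enum_uniq // => u v; rewrite !mem_enum; exact: inj.
  move=> y /mapP[v]; rewrite mem_enum => Hv ->; apply: Hk.
  by move: Hv; rewrite !inE => /and3P[].
have := cardsID E B; have := subset_leq_card (subsetIr B E); lia.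
Qed.

Lemma layer_vertex v : v \in vert G -> layer G D (yy v).
Proof.
by move=> Hv; exists (xl v); left; exists v => //; rewrite on_vseg // eqxx lexx vseg_le.
Qed.

End Layers.

(** * Minima and the theorem *)

Lemma minimum_exists (Q : nat -> Prop) n : Q n -> exists2 m, is_minimum Q m & m <= n.
Proof.
elim/ltn_ind: n => n IH Qn.
(* Excluded middle enters because [Q] is an arbitrary proposition, here the existence of umbrella
   systems. *)
have [[k [Qk Hk]]|H] := classic (exists k, Q k /\ k < n).
  by have [m Hm Hmk] := IH k Hk Qk; exists m => //; apply: leq_trans Hmk (ltnW Hk).
exists n => //; split=> // k Qk; rewrite leqNgt; apply/negP=> Hk.
by apply: H; exists k.
Qed.

Theorem theorem2 (R : realFieldType) (V : finType) (G : sgraph V)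
    (D : drawing R V) (H : nat) :
  maximal_outerplanar G ->
  flat_visibility_representation G D ->
  planar_drawing G D ->
  height G D H ->
  exists2 m : nat, ud_free G m & m <= H - 1.
Proof.
move=> HG HF HP [ks [Uk sk Hk]].
have [a0 [t0 [b0 [U0 Ht0 EG]]]] := maxouter_tree HG.
have Ca0 : a0 \in cyc a0 t0 b0 by rewrite mem_head.
(* The root-edge will be an outer edge at the vertex whose interval ends first. *)
have [w Cw Hw] := @arg_minP _ (R *l int)%type V a0 (mem (cyc a0 t0 b0)) (pos_r G D) Ca0.
have {}Cw : w \in cyc a0 t0 b0 := Cw.
have [t [U Ht Pm E]] : exists t, [/\ uniq (cyc (next (cyc a0 t0 b0) w) t w), t <> Leaf,
    perm_eq (cyc (next (cyc a0 t0 b0) w) t w) (cyc a0 t0 b0) &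
    polygon a0 t0 b0 = polygon (next (cyc a0 t0 b0) w) t w].
  by apply: arcs_root => //; rewrite arcsE //; apply/mapP; exists w.
set a := next _ _ in t U Ht Pm E.
have vG v : (v \in vert G) = (v \in cyc a t w) by rewrite EG E vert_poly in_set.
have aG u v : (u, v) \in drt a t w -> adj G u v by rewrite EG E adj_poly.
have wG : w \in vert G by rewrite vG (perm_mem Pm).
have [k Hud kH] : exists2 k, umbrella_system (polygon a t w) [set a; w] k & k.+2 <= H.+1.
  apply: (@depth_bound V H.+1 _ (R *l int)%type (pos_l D) (pos_r G D) a w w t U Ht).
  - by move=> v; rewrite -vG; apply: pos_le.
  - move=> u v Huv; have [Hu Hv] := drt_cyc Huv; rewrite -!vG in Hu Hv.
    by apply: pos_adj => //; [exact: drt_neq Huv|exact: aG].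
  - by rewrite !inE eqxx orbT.
  - have bagE z : bag (pos_l D) (pos_r G D) (cyc a t w) z =
        [set v in vert G | (pos_l D v <= z <= pos_r G D v)%O].
      by apply/setP=> v; rewrite !in_set vG.
    have HB z : #|bag (pos_l D) (pos_r G D) (cyc a t w) z| <= H.+1.
      rewrite bagE -sk; apply: bag_layers => // v Hv.
      by apply/Hk; apply: layer_vertex.
    (* Vertices alive at a position [z] before the start of [w] are all alive when [w] ends, as none
       ends earlier; [w] joins them there, so the bag at [z] has a free place. *)
    move=> z; case: ltP => Hz; last by rewrite addn0.
    rewrite addn1; apply: leq_trans (HB (pos_r G D w)).
    apply: proper_card; apply/properP; split.
      apply/subsetP=> v; rewrite !in_set => /andP[Hv /andP[Hlv Hrv]]; rewrite Hv /=.
      rewrite /meets (le_trans Hlv (le_trans (ltW Hz) (pos_le HF HP wG))) /=.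
      by apply: Hw; move: Hv; rewrite (perm_mem Pm).
    exists w; rewrite in_set -vG wG //= /meets ?lexx ?(pos_le HF HP) //.
    by rewrite leNgt Hz.
have EP : G = polygon a t w by rewrite EG.
rewrite -EP in Hud.
(* The least depth at this root-edge comes first, then the least value over all root-edges; neither
   exceeds [k]. *)
have [m0 Hm0 le0] := minimum_exists Hud.
have Hex : exists2 B, non_cutting_edge G B & ud G B m0.
  by exists [set a; w] => //; rewrite EP; apply: root_non_cutting.
have [m Hm le1] := minimum_exists (Q := fun k => exists2 B, non_cutting_edge G B & ud G B k) Hex.
exists m => //; apply: leq_trans le1 (leq_trans le0 _); move: kH; lia.
Qed.
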